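(* Consider the two-network stochastic zero-sum game and the iterates of the distributed stochastic mirror descent algorithm (D-SMD) with a non-increasing step-size sequence $\{\alpha(t)\}_{t\ge 0}$, as described in the context. Suppose that for every $i\in\mathcal V_1$ the cost function $f_{1,i}(\cdot,\cdot)$ is convex-concave (convex in $x_1$, concave in $x_2$), and that Assumptions A1, A2, A3 of the context hold. Then for every $i\in\mathcal V_1$ and every $T\ge 1$ the pseudo regret $$\bar R_1^{(i)}(T)=\mathbb E\Big[\sum_{t=1}^T U(x_{1,i}(t),u_{2,i}(t))\Big]-\min_{x_1\in X_1}\mathbb E\Big[\sum_{t=1}^T U(x_1,u_{2,i}(t))\Big]$$ satisfies $$\bar R_1^{(i)}(T)\le \sum_{t=1}^T\sum_{l=1}^2 (L+\nu_l)(9L+\nu_l)\,\alpha(t-1)+4L\sum_{t=1}^T\sum_{l=1}^2 n_l\Gamma_l(L+\nu_l)\sum_{s=1}^{t-1}\theta_l^{\,t-1-s}\alpha(s-1)+4L\sum_{t=1}^T\sum_{l=1}^2 n_l\Gamma_l\theta_l^{\,t-1}\Lambda_l+\frac{R_1^2}{\alpha(T)},$$ where $R_1^2:=\max\{D_{\psi_1}(x_1,x_1'):x_1,x_1'\in X_1\}$ and $\Lambda_l:=\max_{i\in\mathcal V_l}\|x_{l,i}(0)\|$.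
   Context: Game. Two networks $\Sigma_1,\Sigma_2$ have agent sets $\mathcal V_1=\{1,\dots,n_1\}$, $\mathcal V_2=\{1,\dots,n_2\}$. For $l=1,2$ the strategy set $X_l\subset\mathbb R^{m_l}$ is nonempty, compact and convex; $\|\cdot\|$ is a norm and $\|y\|_*=\sup_{\|x\|\le1}\langle y,x\rangle$ its dual norm. The cost is $U(x_1,x_2)=\frac1{n_1}\sum_{i=1}^{n_1}f_{1,i}(x_1,x_2)=-\frac1{n_2}\sum_{j=1}^{n_2}f_{2,j}(x_1,x_2)$ on $X_1\times X_2$, where each $f_{1,i}$ is continuous and convex-concave (convex in $x_1$, concave in $x_2$) and each $f_{2,j}$ is continuous and concave-convex. Each $f_{l,i}(x_1,x_2)=\mathbb E[F_{l,i}(x_1,x_2;\xi)]$ for a random vector $\xi$ in $\mathbb R^d$. $\Sigma_1$ minimizes and $\Sigma_2$ maximizes $U$. $\partial_l$ denotes the subdifferential with respect to $x_l$. Communication. For $l=1,2$ there is a sequence of digraphs $(\mathcal V_l,\mathcal E_l(t))$, $t\ge0$, uniformly jointly strongly connected: there is an integer $B_l\ge1$ such that $(\mathcal V_l,\bigcup_{t=k}^{k+B_l-1}\mathcal E_l(t))$ is strongly connected for all $k\ge0$. There is also a sequence of bipartite digraphs $(\mathcal V_1\cup\mathcal V_2,\mathcal E_{12}(t))$. The nonnegative mixing weights satisfy, for a constant $0<\eta_0<1$: $w_{l,ij}(t)\ge\eta_0$ if $(j,i)\in\mathcal E_l(t)$ and $w_{l,ij}(t)=0$ otherwise; $\sum_{j=1}^{n_l}w_{l,ij}(t)=\sum_{i=1}^{n_l}w_{l,ij}(t)=1$;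 for $i\in\mathcal V_l$, $j\in\mathcal V_{3-l}$, $w_{12,ij}(t)>0$ only if $(j,i)\in\mathcal E_{12}(t)$, and $\sum_{j=1}^{n_{3-l}}w_{12,ij}(t)=1$. Put $\Gamma_l=(1-\eta_0/(4n_l^2))^{-2}$ and $\theta_l=(1-\eta_0/(4n_l^2))^{1/B_l}$. Regularizers. For $l=1,2$, $\psi_l$ is a differentiable function, $1$-strongly convex on $X_l$; $D_{\psi_l}(x,p)=\psi_l(x)-\psi_l(p)-\langle\nabla\psi_l(p),x-p\rangle$; and $P^l_x(y)=\arg\min_{x'\in X_l}\{\langle y,x-x'\rangle+D_{\psi_l}(x',x)\}$. Algorithm D-SMD. Given a non-increasing nonnegative step-size sequence $\{\alpha(t)\}_{t\ge0}$ and initial points $x_{l,i}(0)\in X_l$, for $t=0,1,2,\dots$, $l=1,2$ and $i\in\mathcal V_l$: $v_{l,i}(t)=\sum_{j=1}^{n_l}w_{l,ij}(t)x_{l,j}(t)$; $u_{3-l,i}(t)=\sum_{j=1}^{n_{3-l}}w_{12,ij}(t)x_{3-l,j}(t)$; a sampled subgradient $\hat g_{l,i}(t)$ is received, with $\hat g_{1,i}(t)\in\partial_1F_{1,i}(v_{1,i}(t),u_{2,i}(t);\xi_{1,i}(t))$ and $\hat g_{2,i}(t)\in\partial_2F_{2,i}(u_{1,i}(t),v_{2,i}(t);\xi_{2,i}(t))$, where the $\xi_{l,i}(t)$ are i.i.d. realizations of $\xi$; and $x_{l,i}(t+1)=P^l_{v_{l,i}(t)}(-\alpha(t)\hat g_{l,i}(t))$.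 Let $\mathcal F_t=\sigma\{x_{l,i}(0),\xi_{l,i}(s):l=1,2,\ i\in\mathcal V_l,\ 0\le s\le t-1\}$. Assumptions. (A1) There is $L>0$ with $|f_{l,i}(x_1,x_2)-f_{l,i}(x_1',x_2')|\le L(\|x_1-x_1'\|+\|x_2-x_2'\|)$ for all $l,i$ and all $x_1,x_1'\in X_1$, $x_2,x_2'\in X_2$. (A2) There are $\nu_1,\nu_2>0$ such that for all $l,i,t$: $\mathbb E[\hat g_{l,i}(t)\mid\mathcal F_t]=g_{l,i}(t)$ and $\mathbb E[\|g_{l,i}(t)-\hat g_{l,i}(t)\|_*^2\mid\mathcal F_t]\le\nu_l^2$, where $g_{1,i}(t)\in\partial_1f_{1,i}(v_{1,i}(t),u_{2,i}(t))$ and $g_{2,i}(t)\in\partial_2f_{2,i}(u_{1,i}(t),v_{2,i}(t))$. (A3) For $l=1,2$, $D_{\psi_l}(x,y)$ is convex in $y$, and $x_k\to x$ implies $D_{\psi_l}(x_k,x)\to0$.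
   Formalization: Added, as the claim fails without them: every agent has a self-loop (i,i) in E_l(t) for all t, and the subgradients g_{l,i}(t) of A2 satisfy ||g_{l,i}(t)||_* <= L. Also initial points are deterministic and the sampled subgradients at time t are F_{t+1}-measurable. *)

(* Defs.v *)
From HB Require Import structures.
From mathcomp Require Import all_boot all_order all_algebra.
From mathcomp Require Import all_classical all_reals all_analysis.

Set Implicit Arguments.
Unset Strict Implicit.
Unset Printing Implicit Defensive.

Import Order.TTheory GRing.Theory Num.Theory.
Import numFieldNormedType.Exports.

Local Open Scope classical_set_scope.
Local Open Scope ring_scope.

(* The two networks are indexed by [bool], so that [~~ l] is the opponent of
   [l] (the index 3 - l) and [\sum_(l : bool)] is the sum over both networks. *)
Notation net1 := false.
Notation net2 := true.

Section Euclidean.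
Context {R : realType} {m : nat}.
Implicit Types (X : set 'rV[R]_m) (x y p g : 'rV[R]_m).
Implicit Types (N h psi : 'rV[R]_m -> R).

Definition dot y x : R := \sum_k y ord0 k * x ord0 k.

Definition is_norm N : Prop :=
  [/\ forall x y, N (x + y) <= N x + N y,
      forall (a : R) x, N (a *: x) = `|a| * N x &
      forall x, N x = 0 -> x = 0].

(* A real supremum: the set is nonempty, and bounded when [N] is a norm. *)
Definition dual_norm N y : R := sup [set dot y x | x in [set x | N x <= 1]].

(* [h] is regarded as a function with domain [X]: the subgradient inequality is
   only tested on [X], so normals to [X] may be added at its boundary. *)
Definition subdifferential X h p : set 'rV[R]_m :=
  [set g | X p /\ forall y, X y -> h p + dot g (y - p) <= h y].

(* 1-strong convexity with respect to the norm [N]. *)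
Definition strongly_convex1 N X psi : Prop :=
  forall x y (t : R), X x -> X y -> 0 <= t <= 1 ->
    psi (t *: x + (1 - t) *: y) <=
      t * psi x + (1 - t) * psi y - t * (1 - t) * N (x - y) ^+ 2 / 2.

(* ['d psi p h] is the differential, i.e. the pairing of [h] with the gradient
   of [psi] at [p]. *)
Definition bregman psi x p : R := psi x - psi p - 'd psi p (x - p).

Definition argmin X h : set 'rV[R]_m :=
  [set x | X x /\ forall y, X y -> h x <= h y].

(* [get] picks the minimizer, which exists and is unique when [X] is nonempty,
   compact and convex and [psi] is strongly convex on [X]. *)
Definition mirror_map X psi x y : 'rV[R]_m :=
  get (argmin X (fun x' => dot y (x - x') + bregman psi x' x)).

End Euclidean.

Section Profiles.
Context {R : realType} {m : bool -> nat}.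

Definition profile : Type := ('rV[R]_(m net1) * 'rV[R]_(m net2))%type.

(* The strategy profile in which network [l] plays [own] and network [~~ l]
   plays [opp]; the first component is always the strategy of [net1]. *)
Definition play (l : bool) :
    'rV[R]_(m l) -> 'rV[R]_(m (~~ l)) -> profile :=
  match l return 'rV[R]_(m l) -> 'rV[R]_(m (~~ l)) -> profile with
  | net1 => fun own opp => (own, opp)
  | net2 => fun own opp => (opp, own)
  end.

Definition partial_subdifferential (X : forall l, set 'rV[R]_(m l)) (l : bool)
    (h : profile -> R) (own : 'rV[R]_(m l)) (opp : 'rV[R]_(m (~~ l))) :
    set 'rV[R]_(m l) :=
  subdifferential (X l) (fun y => h (play y opp)) own.

End Profiles.

Arguments profile : clear implicits.

(* [E t j i] means that the arc (j, i) is present at time [t]. *)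
Definition jointly_strongly_connected (n : nat) (E : nat -> rel 'I_n)
    (B : nat) : Prop :=
  forall (k : nat) (i j : 'I_n),
    connect (fun a b => [exists s : 'I_B, E (k + s)%N a b]) i j.

Section Probability.
Context d (T : measurableType d) (R : realType) (P : probability T R).

Definition sub_measurable (G : set (set T)) (Y : T -> R) : Prop :=
  forall B : set R, measurable B -> G (Y @^-1` B).

Definition is_cond_expectation (G : set (set T)) (Y Z : T -> R) : Prop :=
  [/\ P.-integrable setT (EFin \o Y), P.-integrable setT (EFin \o Z),
      sub_measurable G Z &
      forall A, G A -> \int[P]_(w in A) Z w = \int[P]_(w in A) Y w].

Definition mutually_independent d' (S : measurableType d') (I : eqType)
    (X : I -> T -> S) : Prop :=
  forall (s : seq I) (B : I -> set S), uniq s ->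
    (forall k, measurable (B k)) ->
    P (\bigcap_(k in [set` s]) (X k @^-1` B k)) =
      (\prod_(k <- s) P (X k @^-1` B k))%E.

End Probability.

Section Algorithm.
Context {R : realType} {m n : bool -> nat} {d : measure_display}
  {T : measurableType d}.

Implicit Type x : forall l, 'I_(n l) -> nat -> T -> 'rV[R]_(m l).

Definition v_of (w : forall l, nat -> 'I_(n l) -> 'I_(n l) -> R) x
    (l : bool) (i : 'I_(n l)) (t : nat) (o : T) : 'rV[R]_(m l) :=
  \sum_(j < n l) w l t i j *: x l j t o.

(* [u_of w12 x i] with [i] in network [l] estimates the strategy of the network
   [~~ l]: it is u_{3-l,i}. *)
Definition u_of (w12 : forall l, nat -> 'I_(n l) -> 'I_(n (~~ l)) -> R) x
    (l : bool) (i : 'I_(n l)) (t : nat) (o : T) : 'rV[R]_(m (~~ l)) :=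
  \sum_(j < n (~~ l)) w12 l t i j *: x (~~ l) j t o.

Definition history x d' (S : measurableType d')
    (xi : forall l, 'I_(n l) -> nat -> T -> S) (t : nat) : set (set T) :=
  <<s [set A | exists l (i : 'I_(n l)),
         (exists k, preimage_set_system setT (fun o => x l i 0%N o ord0 k)
                      measurable A) \/
         (exists2 s, (s < t)%N &
            preimage_set_system setT (xi l i s) measurable A)] >>.

Definition cost (f : forall l, 'I_(n l) -> profile R m -> R)
    (z : profile R m) : R :=
  (n net1)%:R^-1 * \sum_(i < n net1) f net1 i z.

(* The minimum over [X1] is written as an infimum in the extended reals; it is
   attained as [X1] is compact and the cost is continuous. *)
Definition pseudo_regret (P : probability T R) (X1 : set 'rV[R]_(m net1))
    (U : profile R m -> R) (x1 : nat -> T -> 'rV[R]_(m net1))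
    (u2 : nat -> T -> 'rV[R]_(m net2)) (K : nat) : \bar R :=
  ('E_P[fun o => (\sum_(1 <= t < K.+1) U (x1 t o, u2 t o))%R]
   - ereal_inf [set 'E_P[fun o => (\sum_(1 <= t < K.+1) U (y, u2 t o))%R]
               | y in X1])%E.

End Algorithm.

Section Constants.
Context {R : realType}.

Definition Gam (eta0 : R) (n : nat) : R :=
  (1 - eta0 / (4 * n%:R ^+ 2)) ^- 2.

Definition theta (eta0 : R) (n B : nat) : R :=
  (1 - eta0 / (4 * n%:R ^+ 2)) `^ (B%:R^-1).

(* A supremum in the extended reals, equal
   to the maximum whenever the latter exists. *)
Definition bregman_diameter (m : nat) (psi : 'rV[R]_m -> R)
    (X : set 'rV[R]_m) : \bar R :=
  ereal_sup [set z | exists2 x, X x & exists2 x', X x' &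
                       z = (bregman psi x x')%:E].

End Constants.

(* Main.v *)
(* The instantaneous regret of agent [i] against [y] is compared, for every agent
   [j] of the first network, with [f_j (v_j, u_j) - f_j (y, u_j)]; the Lipschitz
   cost of this change is controlled by the distances of all agents to the
   average of their network.  Convexity, the three-point inequality of the mirror
   step and the fact that [ghat - g] is orthogonal to the bounded, history
   measurable vector [v_j - y] bound what remains by a weighted telescoping sum of
   Bregman divergences, convex in the averaged point, plus [alpha * (L + nu)^2 / 2].

   The distance to the average is governed by products of doubly stochastic
   matrices.  Sort the entries of a mean-zero vector: within a window of [B] steps
   each cut between consecutive values is crossed, and the first crossing
   decreases the sum of squares by at least [eta / 2] times the squared gap, so
   that a window contracts the sum of squares by the factor [1 - eta / (2 n^2)].

   Nothing is assumed about [psi] outside [X], so the measurability of the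
   iterates is obtained from a countable dense subset of [X]: the differential is
   a limit of difference quotients inside [X], and the minimizer is the limit of
   the approximate minimizers in the dense subset. *)
Require Import Defs.
From HB Require Import structures.
From mathcomp Require Import all_boot all_order all_algebra.
From mathcomp Require Import all_classical all_reals all_analysis.
From mathcomp Require Import measurable_realfun.
From mathcomp Require Import ring lra.

Set Implicit Arguments.
Unset Strict Implicit.
Unset Printing Implicit Defensive.

Import Order.TTheory GRing.Theory Num.Theory.
Import numFieldNormedType.Exports.

Local Open Scope classical_set_scope.
Local Open Scope ring_scope.

(** * Contraction of doubly stochastic averaging *)

Section Consensus.
Context {R : realFieldType}.

(** The cost averages all [f net1 j], while a subgradient of [f net1 j] is sampled only at the
    estimates of agent [j]; this forces the exchange of points whose price is the consensus error.
    Inequalities are kept pathwise as long as possible: conditioning serves only for the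
    orthogonality of the noise and for its second moment, and every other passage to the mean is
    linear.

    The factor [1 - eta / (4 n^2)] is a square root of the contraction of the sum of squares, by (1
    - q)^2 >= 1 - 2q. The sum of squares treats each cut separately and loses only n^2: one factor n
    from Cauchy-Schwarz over the gaps, one from summing over the agents.

    The mirror inequality is divided by [alpha t] before it is summed, so the divergences carry
    nondecreasing weights and the last weight gives the term in 1 / alpha(T). The step size may
    reach zero, which makes the end of the proof an argument in the extended reals. *)

Lemma weighted_variance (I : finType) (p a : I -> R) : \sum_i p i = 1 ->
  \sum_i p i * a i ^+ 2 - (\sum_i p i * a i) ^+ 2 =
  2^-1 * \sum_i \sum_j p i * p j * (a i - a j) ^+ 2.
Proof.
move=> p1.
have -> : \sum_i \sum_j p i * p j * (a i - a j) ^+ 2 =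
  \sum_i (p i * a i ^+ 2 - 2 * (p i * a i) * (\sum_j p j * a j)
          + p i * \sum_j p j * a j ^+ 2).
  apply: eq_bigr => i _.
  have -> : p i * a i ^+ 2 = \sum_j p i * a i ^+ 2 * p j.
    by rewrite -mulr_sumr p1 mulr1.
  by rewrite !mulr_sumr -sumrB -big_split /=; apply: eq_bigr => j _; ring.
rewrite big_split /= sumrB -!mulr_suml p1 -mulr_sumr; by field.
Qed.

(** The double sum is the product of the masses [A] and [C] of the two sides, both at least [eta]
    and of sum 1. Expanding (A - eta)(C - eta) >= 0 gives A C >= eta (1 - eta), and eta <= 1/2. *)
Lemma sum_cut_weights (I : finType) (p : I -> R) (S : pred I) (eta : R) (k j : I) :
  0 < eta -> (forall i, 0 <= p i) -> \sum_i p i = 1 ->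
  S k != S j -> eta <= p k -> eta <= p j ->
  eta / 2 <= \sum_(i | S i) \sum_(j | ~~ S j) p i * p j.
Proof.
move=> eta0 p0 p1 Skj pk pj.
under eq_bigr do rewrite -mulr_sumr.
rewrite -mulr_suml.
have := p1; rewrite (bigID S) /=.
set A := \sum_(i | S i) p i; set C := \sum_(i | ~~ S i) p i => AC.
have ge (Q : pred I) i : Q i -> eta <= p i -> eta <= \sum_(i | Q i) p i.
  move=> Qi pi; rewrite (bigD1 i) //= (le_trans pi) // lerDl.
  by apply: sumr_ge0.
have [etaA etaC] : eta <= A /\ eta <= C.
  case Sk : (S k) Skj; case Sj : (S j) => // _; split.
  - exact: (ge _ k).
  - by apply: (ge _ j) => //; rewrite Sj.
  - exact: (ge _ j).
  - by apply: (ge _ k) => //; rewrite Sk.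
have : 0 <= (A - eta) * (C - eta) by rewrite mulr_ge0 ?subr_ge0.
have eta_half : 0 <= eta * (2^-1 - eta) by rewrite mulr_ge0 ?(ltW eta0) //; lra.
have -> : C = 1 - A by rewrite -AC [A + C]addrC addrK.
by lra.
Qed.

(** The gaps are disjoint intervals inside one of length [hi - lo]: each square is at most [hi - lo]
    times the gap, and the gaps add up to at most [hi - lo]. *)
Lemma sum_sq_gaps (y : nat -> R) (m : nat) (Q : pred nat) (lo hi : R) :
  (forall d, y d.+1 <= y d) ->
  (forall d, Q d -> y d <= hi /\ lo <= y d.+1) ->
  \sum_(d < m | Q d) (y d - y d.+1) ^+ 2 <= (hi - lo) ^+ 2.
Proof.
move=> ynon Qy.
have [[d0 Qd0]|noQ] := pselect (exists d : 'I_m, Q d); last first.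
  by rewrite big_pred0 ?sqr_ge0// => d; apply/negP => Qd; apply: noQ; exists d.
have lohi : lo <= hi.
  by have [? ?] := Qy _ Qd0; apply: le_trans (_ : y d0.+1 <= _) => //; apply: le_trans (ynon _) _.
(* Clamping to [lo, hi] leaves the selected gaps unchanged and the others nonnegative, so the sum
   may run over all indices and telescope. *)
pose c z := Num.min hi (Num.max lo z).
have cmono a b : a <= b -> c a <= c b.
  by move=> ab; rewrite /c le_min ge_min lexx /= ge_min ge_max !le_max lexx ab /= !orbT.
have c_id z : lo <= z -> z <= hi -> c z = z.
  by move=> lz zh; rewrite /c max_r // min_r.
have chi z : c z <= hi by rewrite /c ge_min lexx.
have clo z : lo <= c z by rewrite /c le_min lohi le_max lexx.
apply: (@le_trans _ _ (\sum_(d < m) (hi - lo) * (c (y d) - c (y d.+1)))).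
  rewrite [X in _ <= X](bigID (fun d : 'I_m => Q d)) /= -[X in X <= _]addr0; apply: lerD.
    apply: ler_sum => d Qd; have [h1 h2] := Qy _ Qd.
    have h3 := ynon d.
    rewrite !c_id //; [|exact: le_trans h1|exact: le_trans h3].
    rewrite expr2 ler_wpM2r ?subr_ge0 // lerB //.
  by apply: sumr_ge0 => d _; rewrite mulr_ge0 // subr_ge0 // cmono.
rewrite -mulr_sumr expr2 ler_wpM2l ?subr_ge0 //.
rewrite -(big_mkord xpredT (fun d => c (y d) - c (y d.+1))).
rewrite (telescope_sumr_eq (fun d => - c (y d))) // => [|d _]; last first.
  by rewrite opprK addrC.
by rewrite opprK addrC lerB.
Qed.

(** Each row loses its variance; unit column sums turn the sum of the row averages of squares back
    into the plain sum of squares. *)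
Lemma sum_sq_averaging (I : finType) (W : I -> I -> R) (a : I -> R) :
  (forall i, \sum_j W i j = 1) -> (forall j, \sum_i W i j = 1) ->
  \sum_i a i ^+ 2 - \sum_i (\sum_j W i j * a j) ^+ 2 =
  \sum_k 2^-1 * \sum_i \sum_j W k i * W k j * (a i - a j) ^+ 2.
Proof.
move=> row col.
under [RHS]eq_bigr do rewrite -weighted_variance //.
rewrite sumrB exchange_big /=; congr (_ - _).
by apply: eq_bigr => i _; rewrite -mulr_suml col mul1r.
Qed.

Lemma sq_sum_le (I : finType) (a : I -> R) :
  (\sum_i a i) ^+ 2 <= #|I|%:R * \sum_i a i ^+ 2.
Proof.
have : 0 <= 2^-1 * \sum_(i : I) \sum_(j : I) (a i - a j) ^+ 2.
  apply: mulr_ge0; first by rewrite invr_ge0 ler0n.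
  by do 2!(apply: sumr_ge0 => ? _); exact: sqr_ge0.
have -> : \sum_(i : I) \sum_(j : I) (a i - a j) ^+ 2 =
  \sum_(i : I) (#|I|%:R * a i ^+ 2 - 2 * a i * (\sum_j a j) + \sum_j a j ^+ 2).
  apply: eq_bigr => i _.
  have -> : #|I|%:R * a i ^+ 2 = \sum_(j : I) a i ^+ 2.
    by rewrite sumr_const mulr_natl.
  by rewrite !mulr_sumr -sumrB -big_split /=; apply: eq_bigr => j _; ring.
rewrite big_split sumrB /= -mulr_suml -!mulr_sumr sumr_const -mulr_natl expr2.
by move=> h; lra.
Qed.

(** * Decrease of the sum of squares over one communication window *)

Section Window.
Variables (n : nat) (W : nat -> 'I_n -> 'I_n -> R) (E : nat -> rel 'I_n).
Variables (eta : R) (B : nat).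
Hypotheses (eta0 : 0 < eta) (W0 : forall t i j, 0 <= W t i j).
Hypotheses (Eself : forall t i, E t i i).
Hypotheses (WE : forall t i j, E t j i -> eta <= W t i j).
Hypotheses (WnE : forall t i j, ~~ E t j i -> W t i j = 0).
Hypotheses (Wrow : forall t i, \sum_j W t i j = 1).
Hypotheses (Wcol : forall t j, \sum_i W t i j = 1).
Variable a : nat -> 'I_n -> R.
Hypothesis aS : forall t i, a t.+1 i = \sum_j W t i j * a t j.

(* [y] lists the initial values in nonincreasing order and [r i] is the rank of
   agent [i] in this list; the cut [d] separates the ranks [<= d] from the others. *)
Variables (y : nat -> R) (r : 'I_n -> nat).
Hypotheses (ynon : forall d, y d.+1 <= y d) (a0 : forall i, a 0%N i = y (r i)).

Let crossed t d := [exists k, exists j, E t j k && ((r k <= d)%N != (r j <= d)%N)].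

(** While no arc joins the two sides of the cut, each side averages only its own values and cannot
    leave the half-line in which it started. *)
Lemma averaging_uncrossed t d : (forall s, (s < t)%N -> ~~ crossed s d) ->
  forall i, if (r i <= d)%N then y d <= a t i else a t i <= y d.+1.
Proof.
have ymono e e' : (e <= e')%N -> y e' <= y e.
  by move=> /subnK <-; elim: (e' - e)%N => // q IH; rewrite addSn (le_trans (ynon _)).
elim: t => [|t IH] unc i; first by rewrite a0; case: leqP => h; exact: ymono.
have {}IH := IH (fun s st => unc s (leqW st)).
have side j : ~~ E t j i \/ (r i <= d)%N = (r j <= d)%N.
  have := unc t (ltnSn t); rewrite /crossed => /existsPn /(_ i) /existsPn /(_ j).
  by rewrite negb_and negbK => /orP[->|/eqP ->]; [left|right].
rewrite aS; case: ifP => rid.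
  rewrite -[y d]mul1r -(Wrow t i) mulr_suml; apply: ler_sum => j _.
  have [/WnE->|sj] := side j; first by rewrite !mul0r.
  by have := IH j; rewrite -sj rid => h; rewrite ler_wpM2l.
rewrite -[y d.+1]mul1r -(Wrow t i) mulr_suml; apply: ler_sum => j _.
have [/WnE->|sj] := side j; first by rewrite !mul0r.
by have := IH j; rewrite -sj rid => h; rewrite ler_wpM2l.
Qed.

(** A cut is charged only at its first crossing, when its two sides are still separated by the whole
    initial gap. *)
Let first_crossed t d :=
  crossed t d && [forall s : 'I_t, ~~ crossed s d].

(** The lost variance is distributed over the newly crossed cuts. A pair separated by several of
    them pays for all by [sum_sq_gaps]; and an agent receiving an arc across a cut puts weight at
    least [eta] on both sides, on its own side through its self-loop. *)
Lemma sum_sq_step_decrease m t :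
  eta / 2 * \sum_(d < m | first_crossed t d) (y d - y d.+1) ^+ 2 <=
  \sum_i a t i ^+ 2 - \sum_i a t.+1 i ^+ 2.
Proof.
have -> : \sum_i a t.+1 i ^+ 2 = \sum_i (\sum_j W t i j * a t j) ^+ 2.
  by apply: eq_bigr => i _; rewrite aS.
rewrite sum_sq_averaging //.
pose g d := (y d - y d.+1) ^+ 2.
pose c k i j := W t k i * W t k j.
have c0 k i j : 0 <= c k i j by rewrite mulr_ge0.
have unc d : first_crossed t d -> forall s, (s < t)%N -> ~~ crossed s d.
  by move=> /andP[_ /forallP h] s st; exact: (h (Ordinal st)).
(* each unordered pair is counted twice on the right, once on the left *)
apply: (@le_trans _ _ (\sum_k \sum_i \sum_(j | (r i < r j)%N)
    c k i j * (a t i - a t j) ^+ 2)); last first.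
  apply: ler_sum => k _.
  have sym : \sum_i \sum_(j | (r i < r j)%N) c k i j * (a t i - a t j) ^+ 2 =
             \sum_i \sum_(j | (r j < r i)%N) c k i j * (a t i - a t j) ^+ 2.
    under eq_bigr do rewrite big_mkcond /=.
    rewrite exchange_big /=; apply: eq_bigr => i _; rewrite [RHS]big_mkcond /=.
    by apply: eq_bigr => j _; case: ifP => // _; rewrite /c; ring.
  have : \sum_i \sum_(j | (r i < r j)%N) c k i j * (a t i - a t j) ^+ 2 +
         \sum_i \sum_(j | (r j < r i)%N) c k i j * (a t i - a t j) ^+ 2 <=
         \sum_i \sum_j c k i j * (a t i - a t j) ^+ 2.
    rewrite -big_split /=; apply: ler_sum => i _.
    rewrite big_mkcond [X in _ + X <= _]big_mkcond -big_split /=.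
    apply: ler_sum => j _.
    by case: ltngtP => _; rewrite ?addr0 ?add0r // mulr_ge0 ?sqr_ge0.
  rewrite -sym; set v := \sum_i \sum_j _; set u := \sum_i \sum_(j | _) _ => h.
  by change (u <= 2^-1 * v); lra.
apply: (@le_trans _ _ (\sum_k \sum_i \sum_(j | (r i < r j)%N)
    c k i j * \sum_(d < m | first_crossed t d && ((r i <= d)%N && ~~ (r j <= d)%N)) g d)); last first.
  apply: ler_sum => k _; apply: ler_sum => i _; apply: ler_sum => j _; apply: ler_wpM2l => //.
  apply: (@sum_sq_gaps y m (fun d => first_crossed t d &&
    ((r i <= d)%N && ~~ (r j <= d)%N))) => // d /andP[fc /andP[ri rj]].
  have h1 := averaging_uncrossed (unc d fc).
  by split; [move: (h1 i)|move: (h1 j)]; rewrite ?ri ?(negbTE rj).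
(* Exchanging the sums groups the pairs by cut; [r i < r j] follows once [d] separates the two
   ranks. *)
have -> : \sum_k \sum_i \sum_(j | (r i < r j)%N)
    c k i j * \sum_(d < m | first_crossed t d && ((r i <= d)%N && ~~ (r j <= d)%N)) g d =
  \sum_(d < m | first_crossed t d)
    g d * \sum_k \sum_(i | (r i <= d)%N) \sum_(j | ~~ (r j <= d)%N) c k i j.
  transitivity (\sum_k \sum_i \sum_j \sum_(d < m | first_crossed t d)
      if (r i <= d)%N && ~~ (r j <= d)%N then g d * c k i j else 0).
    apply: eq_bigr => k _; apply: eq_bigr => i _; rewrite big_mkcond /=.
    apply: eq_bigr => j _; case: ltnP => ij.
      by rewrite mulr_sumr big_mkcondr /=; apply: eq_bigr => d _; rewrite mulrC.
    rewrite big1 // => d _; case: ifP => // /andP[rid].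
    by rewrite (leq_trans ij rid).
  under [RHS]eq_bigr do rewrite mulr_sumr.
  rewrite [RHS]exchange_big /=; apply: eq_bigr => k _.
  under [RHS]eq_bigr do rewrite mulr_sumr big_mkcond.
  rewrite [RHS]exchange_big /=; apply: eq_bigr => i _.
  rewrite exchange_big /=; apply: eq_bigr => d _.
  case: ifP => rid /=; last by rewrite big1.
  by rewrite mulr_sumr [RHS]big_mkcond.
rewrite mulr_sumr; apply: ler_sum => d /andP[/existsP[k /existsP[j /andP[Ejk cut]]] _].
rewrite mulrC ler_wpM2l ?sqr_ge0 // (bigD1 k) //=.
apply: (@le_trans _ _ (\sum_(i | (r i <= d)%N) \sum_(j | ~~ (r j <= d)%N) c k i j)).
  by apply: (@sum_cut_weights _ _ (fun i => (r i <= d)%N) eta k j) => //; exact: WE.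
by rewrite lerDl; do 3!(apply: sumr_ge0 => ? _); exact: c0.
Qed.

Hypothesis conn : forall i j,
  connect (fun p q => [exists s : 'I_B, E s p q]) i j.

Lemma cut_crossed d i j : (r i <= d)%N -> (d < r j)%N -> exists t : 'I_B, crossed t d.
Proof.
move=> rid rjd; have /connectP[p] := conn i j.
elim: p i rid => [|k p IH] i rid /= => [_ ji|/andP[/existsP[s Eik] pp] jl].
  by move: rjd; rewrite ji ltnNge rid.
have [rkd|rkd] := leqP (r k) d; first exact: IH rkd pp jl.
exists s; apply/existsP; exists k; apply/existsP; exists i.
by rewrite Eik rid leqNgt rkd.
Qed.

Lemma sum_sq_window_decrease m :
  (forall d, (d < m)%N -> exists i j, (r i <= d)%N /\ (d < r j)%N) ->
  eta / 2 * \sum_(d < m) (y d - y d.+1) ^+ 2 <=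
  \sum_i a 0%N i ^+ 2 - \sum_i a B i ^+ 2.
Proof.
move=> cuts.
have -> : \sum_i a 0%N i ^+ 2 - \sum_i a B i ^+ 2 =
    \sum_(t < B) (\sum_i a t i ^+ 2 - \sum_i a t.+1 i ^+ 2).
  rewrite -(big_mkord xpredT (fun t => \sum_i a t i ^+ 2 - \sum_i a t.+1 i ^+ 2)).
  rewrite (telescope_sumr_eq (fun t => - \sum_i a t i ^+ 2)) // => [|t _].
    by rewrite opprK addrC.
  by rewrite opprK addrC.
apply: (@le_trans _ _ (\sum_(t < B) eta / 2 *
    \sum_(d < m | first_crossed t d) (y d - y d.+1) ^+ 2)); last first.
  by apply: ler_sum => t _; exact: sum_sq_step_decrease.
rewrite -mulr_sumr ler_wpM2l ?divr_ge0 ?(ltW eta0) ?ler0n //.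
under [X in _ <= X]eq_bigr do rewrite big_mkcond /=.
rewrite exchange_big /=; apply: ler_sum => d _.
have [i [j [rid rjd]]] := cuts d (ltn_ord d).
have [t0 ct0] := cut_crossed rid rjd.
have ex : exists t, crossed t d by exists t0.
(* The first crossing of [d] precedes or equals [t0], hence falls inside the window, and its term
   alone already contains the gap of [d]. *)
case: (ex_minnP ex) => t ct tmin.
have tB : (t < B)%N by rewrite (leq_ltn_trans (tmin _ ct0)).
rewrite (bigD1 (Ordinal tB)) //= ifT ?lerDl.
  by apply: sumr_ge0 => s _; case: ifP => // _; exact: sqr_ge0.
rewrite /first_crossed ct; apply/forallP => s; apply/negP => /tmin.
by rewrite leqNgt ltn_ord.
Qed.
End Window.

(** For mean zero the sum of squares is [n] times the variance under uniform weights. Two entries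
    differ by a sum of fewer than [n] gaps, so by Cauchy-Schwarz the variance is at most [n * G],
    with [G] the sum of squared gaps that bounds the decrease from below. *)
Lemma sum_sq_window_contraction (n : nat) (W : nat -> 'I_n -> 'I_n -> R)
    (E : nat -> rel 'I_n) (eta : R) (B : nat) (a : nat -> 'I_n -> R) :
  (0 < n)%N -> 0 < eta -> (forall t i j, 0 <= W t i j) ->
  (forall t i, E t i i) -> (forall t i j, E t j i -> eta <= W t i j) ->
  (forall t i j, ~~ E t j i -> W t i j = 0) ->
  (forall t i, \sum_j W t i j = 1) -> (forall t j, \sum_i W t i j = 1) ->
  (forall t i, a t.+1 i = \sum_j W t i j * a t j) ->
  (forall i j, connect (fun p q => [exists s : 'I_B, E s p q]) i j) ->
  \sum_i a 0%N i = 0 ->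
  \sum_i a B i ^+ 2 <= (1 - eta / (2 * n%:R ^+ 2)) * \sum_i a 0%N i ^+ 2.
Proof.
move=> n0 eta0 W0 Es WE WnE row col aS conn mean0.
pose i0 := Ordinal n0.
pose ge_a i j := a 0%N j <= a 0%N i.
pose e := sort ge_a (enum 'I_n).
have se : size e = n by rewrite size_sort size_enum_ord.
have ie i : i \in e by rewrite mem_sort mem_enum.
have ue : uniq e by rewrite sort_uniq enum_uniq.
have gtr : transitive ge_a by move=> x u z h1 h2; apply: le_trans h1.
have sorte : sorted ge_a e by apply: sort_sorted => x u; rewrite /ge_a le_total.
(* The index is capped at [n.-1], so that [y] is nonincreasing on all of [nat]. *)
pose y d := a 0%N (nth i0 e (minn d n.-1)).
pose r i := index i e.
have nn : n = n.-1.+1 by rewrite prednK.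
have rn i : (r i <= n.-1)%N by rewrite -ltnS -nn -[X in (_ < X)%N]se index_mem.
have ar i : a 0%N i = y (r i) by rewrite /y (minn_idPl (rn i)) nth_index.
have ynon d : y d.+1 <= y d.
  have ref : reflexive ge_a by move=> x; rewrite /ge_a.
  apply: (@sorted_leq_nth _ _ gtr ref i0 e sorte);
    rewrite ?inE ?se ?[X in (_ < X)%N]nn ?ltnS ?geq_minr //.
  by rewrite leq_min geq_minr geq_min leqnSn.
have ymono d d' : (d <= d')%N -> y d' <= y d.
  by move=> /subnK <-; elim: (d' - d)%N => // q IH; rewrite addSn (le_trans (ynon _)).
have dec := @sum_sq_window_decrease n W E eta B eta0 W0 Es WE WnE row col a aS y r ynon ar conn n.-1.
have {}dec : eta / 2 * \sum_(d < n.-1) (y d - y d.+1) ^+ 2 <=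
  \sum_i a 0%N i ^+ 2 - \sum_i a B i ^+ 2.
  apply: dec => d dn; exists (nth i0 e 0); exists (nth i0 e d.+1).
  by rewrite /r !index_uniq ?se // nn ltnS.
set G := \sum_(d < n.-1) _ in dec.
have G0 : 0 <= G by apply: sumr_ge0 => d _; exact: sqr_ge0.
have spread i j : (a 0%N i - a 0%N j) ^+ 2 <= n%:R * G.
  apply: (@le_trans _ _ ((y 0 - y n.-1) ^+ 2)).
    rewrite -subr_ge0 subr_sqr !ar.
    have := ymono _ _ (rn i); have := ymono _ _ (rn j).
    have := ymono _ _ (leq0n (r i)); have := ymono _ _ (leq0n (r j)).
    by move=> *; rewrite mulr_ge0 //; lra.
  have -> : y 0%N - y n.-1 = \sum_(d < n.-1) (y d - y d.+1).
    rewrite -(big_mkord xpredT (fun d => y d - y d.+1)).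
    rewrite (telescope_sumr_eq (fun d => - y d)) // => [|d _].
      by rewrite opprK addrC.
    by rewrite opprK addrC.
  apply: le_trans (sq_sum_le _) _; rewrite card_ord ler_wpM2r // ler_nat.
  exact: leq_pred.
have nR0 : 0 < n%:R :> R by rewrite ltr0n.
have bound : \sum_i a 0%N i ^+ 2 <= n%:R ^+ 2 * G.
  have p1 : \sum_(i < n) n%:R^-1 = 1 :> R.
    by rewrite sumr_const card_ord -[LHS]mulr_natr mulVf ?gt_eqF.
  have := @weighted_variance _ (fun=> n%:R^-1) (a 0%N) p1.
  rewrite -!mulr_sumr mean0 mulr0 expr0n subr0 => var.
  have -> : \sum_i a 0%N i ^+ 2 = n%:R * (n%:R^-1 * \sum_i a 0%N i ^+ 2).
    by rewrite mulrA mulfV ?mul1r ?gt_eqF.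
  rewrite var expr2 -mulrA ler_wpM2l ?ler0n //.
  apply: (@le_trans _ _ (2^-1 * \sum_(i < n) \sum_(j < n) n%:R^-1 / n%:R * (n%:R * G))).
    rewrite ler_wpM2l ?invr_ge0 ?ler0n //; apply: ler_sum => i _; apply: ler_sum => j _.
    by rewrite ler_wpM2l ?divr_ge0 ?invr_ge0 ?ler0n.
  rewrite !sumr_const card_ord -[X in _ * X]mulr_natr -[X in _ * (X * _)]mulr_natr.
  have -> : 2^-1 * (n%:R^-1 / n%:R * (n%:R * G) * n%:R * n%:R) = 2^-1 * (n%:R * G).
    by field; rewrite gt_eqF.
  by rewrite ler_piMl ?mulr_ge0 ?ler0n // invf_le1 ?ler1n ?ltr0n.
have : eta / (2 * n%:R ^+ 2) * \sum_i a 0%N i ^+ 2 <= eta / 2 * G.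
  apply: (@le_trans _ _ (eta / (2 * n%:R ^+ 2) * (n%:R ^+ 2 * G))).
    by rewrite ler_wpM2l // divr_ge0 ?(ltW eta0) // mulr_ge0 ?ler0n ?sqr_ge0.
  by rewrite le_eqVlt; apply/orP; left; apply/eqP; field; rewrite gt_eqF.
lra.
Qed.
End Consensus.

(** * Geometric convergence of products of mixing matrices *)

Section TransitionMatrix.
Context {R : realType}.
Variables (n : nat) (W : nat -> 'I_n -> 'I_n -> R).

(** The matrix product W(s + tau - 1) ... W(s), latest factor on the left; the empty product is the
    identity. *)
Fixpoint transition (s tau : nat) (i j : 'I_n) : R :=
  if tau is tau'.+1 then \sum_k W (s + tau')%N i k * transition s tau' k j
  else (i == j)%:R.

Variables (E : nat -> rel 'I_n) (eta : R) (B : nat).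
Hypotheses (n0 : (0 < n)%N) (eta01 : 0 < eta < 1).
Hypotheses (W0 : forall t i j, 0 <= W t i j).
Hypotheses (Eself : forall t i, E t i i).
Hypotheses (WE : forall t i j, E t j i -> eta <= W t i j).
Hypotheses (WnE : forall t i j, ~~ E t j i -> W t i j = 0).
Hypotheses (Wrow : forall t i, \sum_j W t i j = 1).
Hypotheses (Wcol : forall t j, \sum_i W t i j = 1).
Hypothesis B1 : (1 <= B)%N.
Hypothesis conn : jointly_strongly_connected E B.

Lemma col_sum_transition s tau j : \sum_i transition s tau i j = 1.
Proof.
elim: tau => [|tau IH] /=.
  rewrite (bigD1 j) //= eqxx big1 ?addr0 // => i ij; by rewrite (negbTE ij).
rewrite exchange_big /= -[RHS]IH; apply: eq_bigr => k _.
by rewrite -mulr_suml Wcol mul1r.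
Qed.

Let c : R := 1 - eta / (4 * n%:R ^+ 2).

(** With q = eta / (4 n^2) this is 1 - 2q <= (1 - q)^2: it converts the contraction of the sum of
    squares into the factor [c] for the Euclidean norm. *)
Lemma contraction_factor : 0 < c < 1 /\ 1 - eta / (2 * n%:R ^+ 2) <= c ^+ 2.
Proof.
have nR1 : 1 <= n%:R :> R by rewrite ler1n.
have [e0 e1] := andP eta01.
have n2 : 1 <= n%:R ^+ 2 :> R by rewrite exprn_ege1.
have q0 : 0 < eta / (4 * n%:R ^+ 2) by rewrite divr_gt0 // mulr_gt0 // ?ltr0n //; lra.
have q1 : eta / (4 * n%:R ^+ 2) < 1 by rewrite ltr_pdivrMr ?mul1r; lra.
have -> : eta / (2 * n%:R ^+ 2) = 2 * (eta / (4 * n%:R ^+ 2)).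
  by field; rewrite gt_eqF ?ltr0n.
rewrite /c; set q := eta / (4 * _) in q0 q1 *; split; first by lra.
by rewrite -subr_ge0 (_ : _ - _ = q ^+ 2) ?sqr_ge0 //; ring.
Qed.

Section Trajectory.
Variables (s : nat) (a : nat -> 'I_n -> R).
Hypothesis aS : forall t i, a t.+1 i = \sum_j W (s + t)%N i j * a t j.
Hypothesis mean0 : \sum_i a 0%N i = 0.

Lemma trajectory_mean0 t : \sum_i a t i = 0.
Proof.
elim: t => // t IH; under eq_bigr do rewrite aS.
rewrite exchange_big /= -[RHS]IH; apply: eq_bigr => k _.
by rewrite -mulr_suml Wcol mul1r.
Qed.

Lemma sum_sq_nonincreasing t : \sum_i a t.+1 i ^+ 2 <= \sum_i a t i ^+ 2.
Proof.
under [X in X <= _]eq_bigr do rewrite aS.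
rewrite -subr_ge0 sum_sq_averaging //; apply: sumr_ge0 => k _.
apply: mulr_ge0; first by rewrite invr_ge0 ler0n.
by do 2!(apply: sumr_ge0 => ? _); rewrite mulr_ge0 ?sqr_ge0 // mulr_ge0.
Qed.

(** Each of the [q] complete windows contracts by [c ^+ 2], and the [u] remaining steps do not
    increase the sum of squares. *)
Lemma sum_sq_geometric q u :
  \sum_i a (q * B + u)%N i ^+ 2 <= (c ^+ q) ^+ 2 * \sum_i a 0%N i ^+ 2.
Proof.
have [c01 cc] := contraction_factor.
elim: u => [|u IH]; last first.
  by rewrite addnS; apply: le_trans (sum_sq_nonincreasing _) IH.
rewrite addn0; elim: q => [|q IH]; first by rewrite expr0 expr1n mul1r.
have [e0 e1] := andP eta01.
have := @sum_sq_window_contraction R n (fun t => W (s + q * B + t)%N) (fun t => E (s + q * B + t)%N)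
  eta B (fun t => a (q * B + t)%N) n0 e0.
rewrite addn0 mulSn [(B + _)%N]addnC => h.
apply: le_trans (h _ _ _ _ _ _ _ _ _) _ => //.
- by move=> t i j; exact: WE.
- by move=> t i j; exact: WnE.
- by move=> t i; rewrite addnS aS addnA.
- exact: trajectory_mean0.
set V := \sum_i _ in IH *; have V0 : 0 <= V by apply: sumr_ge0 => i _; exact: sqr_ge0.
rewrite [c ^+ q.+1]exprS exprMn -mulrA; apply: (@le_trans _ _ (c ^+ 2 * V)).
  exact: ler_wpM2r.
by rewrite ler_wpM2l ?sqr_ge0.
Qed.
End Trajectory.

(** Column [j] minus [1 / n] is a mean-zero trajectory whose initial sum of squares is 1 - 1/n, and
    one entry is at most the Euclidean norm. *)
Lemma transition_near_uniform s tau i j :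
  `|transition s tau.+1 i j - n%:R^-1| <= Gam eta n * theta eta n B ^+ tau.
Proof.
have [/andP[c0 c1] _] := contraction_factor.
pose a t i := transition s t i j - n%:R^-1.
have nR0 : 0 < n%:R :> R by rewrite ltr0n.
have aS t k : a t.+1 k = \sum_l W (s + t)%N k l * a t l.
  rewrite /a /=; under [RHS]eq_bigr do rewrite mulrBr.
  by rewrite sumrB -mulr_suml Wrow mul1r.
have mean0 : \sum_k a 0%N k = 0.
  by rewrite sumrB (col_sum_transition s 0) sumr_const card_ord -[X in _ - X]mulr_natr
    mulVf ?subrr ?gt_eqF.
have V0 : \sum_k a 0%N k ^+ 2 <= 1.
  have -> : \sum_k a 0%N k ^+ 2 = \sum_k ((k == j)%:R * (1 - 2 / n%:R) + n%:R^-1 / n%:R).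
    by apply: eq_bigr => k _; rewrite /a /=; case: eqP => _ /=; rewrite ?mulr1n ?mulr0n; field;
      rewrite gt_eqF.
  rewrite big_split /= -mulr_suml (col_sum_transition s 0) sumr_const card_ord.
  rewrite -[X in _ + X]mulr_natr -mulrA mulVf ?gt_eqF // mul1r mulr1.
  have : 0 < n%:R^-1 :> R by rewrite invr_gt0.
  by lra.
pose q := (tau.+1 %/ B)%N.
have h : `|a tau.+1 i| <= c ^+ q.
  rewrite -(@ler_pXn2r _ 2) ?nnegrE ?exprn_ge0 ?(ltW c0) //.
  rewrite real_normK ?num_real //.
  apply: (@le_trans _ _ (\sum_k a tau.+1 k ^+ 2)).
    by rewrite (bigD1 i) //= lerDl sumr_ge0 // => k _; rewrite sqr_ge0.
  rewrite [X in a X](divn_eq tau.+1 B).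
  apply: le_trans (sum_sq_geometric aS mean0 _ _) _.
  by rewrite ler_piMr ?sqr_ge0.
apply: (le_trans h).
have thB : theta eta n B ^+ B = c.
  by rewrite /theta -/c -powR_mulrn ?powR_ge0 // -powRrM mulVf ?powRr1 ?(ltW c0) // pnatr_eq0 -lt0n.
have th0 : 0 <= theta eta n B by rewrite powR_ge0.
have th1 : theta eta n B <= 1.
  rewrite leNgt; apply/negP => th1; have : 1 < theta eta n B ^+ B.
    by rewrite exprn_egt1 // -lt0n.
  by rewrite thB ltNge (ltW c1).
have tq : (tau <= q.+1 * B)%N.
  exact: leq_trans (leqnSn _) (ltnW (ltn_ceil tau.+1 B1)).
have thtau : c ^+ q.+1 <= theta eta n B ^+ tau.
  rewrite -thB -exprM mulnC; apply: ler_wiXn2l => //.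
(* One factor [c^-1] of [Gam] pays for rounding down to [q] windows, since only [c ^+ q.+1] is known
   to lie below [theta ^+ tau]; the other factor is at least 1. *)
apply: (@le_trans _ _ (c ^- 2 * c ^+ q.+1)); last first.
  by rewrite ler_wpM2l // invr_ge0 exprn_ge0 ?(ltW c0).
have -> : c ^- 2 * c ^+ q.+1 = c^-1 * c ^+ q.
  by rewrite [c ^+ q.+1]exprS; field; rewrite gt_eqF.
by rewrite ler_peMl ?exprn_ge0 ?(ltW c0) // invf_ge1 // ltW.
Qed.
End TransitionMatrix.

(** * Norms on row vectors *)

Lemma sup_norm_ge_coord {R : realType} {m : nat} (x : 'rV[R]_m) k : `|x ord0 k| <= `|x|.
Proof.
rewrite [leRHS]/Num.norm /= mx_normrE.
exact: (le_bigmax _ (fun ij : 'I_1 * 'I_m => `|x ij.1 ij.2|) (ord0, k)).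
Qed.

Lemma lipschitz_continuous {R : realType} {m : nat} (h : 'rV[R]_m -> R) (C : R) :
  0 < C -> (forall x y, `|h x - h y| <= C * `|x - y|) -> continuous h.
Proof.
move=> C0 hC x; apply/(@cvgrPdist_le _ _ _ (nbhs x)) => e e0.
apply/(@nbhs_normP _ 'rV[R]_m).
exists (e / C) => [/=|y /= xy]; first exact: divr_gt0.
by apply: le_trans (hC _ _) _; rewrite mulrC -ler_pdivlMr // ltW.
Qed.

Section Dot.
Context {R : realType} {m : nat}.
Implicit Types x y z : 'rV[R]_m.

Lemma dotD y x z : dot y (x + z) = dot y x + dot y z.
Proof. by rewrite /dot -big_split; apply: eq_bigr => k _; rewrite !mxE mulrDr. Qed.

Lemma dotB y x z : dot y (x - z) = dot y x - dot y z.
Proof. by rewrite /dot -sumrB; apply: eq_bigr => k _; rewrite !mxE mulrBr. Qed.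

Lemma dotZ y (a : R) z : dot y (a *: z) = a * dot y z.
Proof. by rewrite /dot mulr_sumr; apply: eq_bigr => k _; rewrite mxE mulrCA. Qed.

Lemma dotN y z : dot y (- z) = - dot y z.
Proof. by rewrite -scaleN1r dotZ mulN1r. Qed.

Lemma dotBl y x z : dot (y - x) z = dot y z - dot x z.
Proof. by rewrite /dot -sumrB; apply: eq_bigr => k _; rewrite !mxE mulrBl. Qed.

Lemma dotZl (a : R) y z : dot (a *: y) z = a * dot y z.
Proof. by rewrite /dot mulr_sumr; apply: eq_bigr => k _; rewrite mxE mulrA. Qed.

Lemma dotNl y z : dot (- y) z = - dot y z.
Proof. by rewrite -scaleN1r dotZl mulN1r. Qed.

Lemma dot_le_sup_norm (y x : 'rV[R]_m) : dot y x <= (\sum_k `|y ord0 k|) * `|x|.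
Proof.
rewrite mulr_suml; apply: ler_sum => k _.
apply: le_trans (ler_norm _) _; rewrite normrM ler_wpM2l // .
exact: sup_norm_ge_coord.
Qed.

Lemma dist_dot_le y x z : `|dot y x - dot y z| <= (1 + \sum_k `|y ord0 k|) * `|x - z|.
Proof.
have h u : dot y u <= (1 + \sum_k `|y ord0 k|) * `|u|.
  by apply: le_trans (dot_le_sup_norm _ _) _; rewrite ler_wpM2r // lerDr.
have h1 := h (x - z); have := h (z - x); rewrite distrC !dotB in h1 *.
by rewrite ler_norml => *; apply/andP; split; lra.
Qed.
End Dot.

Section Norm.
Context {R : realType} {m : nat}.
Variable N : 'rV[R]_m -> R.
Hypothesis HN : is_norm N.

Let ND x y : N (x + y) <= N x + N y. Proof. by case: HN. Qed.
Let NZ (a : R) x : N (a *: x) = `|a| * N x. Proof. by case: HN. Qed.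

Lemma gauge0 : N 0 = 0.
Proof. by rewrite -(scale0r 0) NZ normr0 mul0r. Qed.

Lemma gaugeN x : N (- x) = N x.
Proof. by rewrite -scaleN1r NZ normrN1 mul1r. Qed.

Lemma gauge_ge0 x : 0 <= N x.
Proof. by have := ND x (- x); rewrite subrr gauge0 gaugeN; lra. Qed.

Lemma gauge_distC x y : N (x - y) = N (y - x).
Proof. by rewrite -gaugeN opprB. Qed.

Lemma gauge_triangle y x z : N (x - z) <= N (x - y) + N (y - z).
Proof. by have := ND (x - y) (y - z); rewrite addrA subrK. Qed.

Lemma gauge_sum (I : Type) (s : seq I) (P : pred I) (a : I -> 'rV[R]_m) :
  N (\sum_(i <- s | P i) a i) <= \sum_(i <- s | P i) N (a i).
Proof.
elim/big_ind2 : _ => [|x u y v xu yv|//]; first by rewrite gauge0.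
by apply: le_trans (ND _ _) _; apply: lerD.
Qed.

Lemma gauge_convex_dist (I : finType) (p : I -> R) (a : I -> 'rV[R]_m) z :
  (forall i, 0 <= p i) -> \sum_i p i = 1 ->
  N (\sum_i p i *: a i - z) <= \sum_i p i * N (a i - z).
Proof.
move=> p0 p1; have zE : z = \sum_i p i *: z by rewrite -scaler_suml p1 scale1r.
rewrite {1}zE -sumrB.
apply: le_trans (gauge_sum _ _ _) _; apply: ler_sum => i _.
by rewrite -scalerBr NZ ger0_norm.
Qed.

Lemma gauge_le_sup_norm : exists2 C, 0 < C & forall x, N x <= C * `|x|.
Proof.
exists (1 + \sum_k N (delta_mx ord0 k)) => [|x].
  by rewrite ltr_pwDl // sumr_ge0 // => k _; exact: gauge_ge0.
rewrite {1}(row_sum_delta x); apply: le_trans (gauge_sum _ _ _) _.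
rewrite mulrDl mulr_suml ler_wpDl ?mul1r //; apply: ler_sum => k _.
rewrite NZ mulrC ler_wpM2l ?gauge_ge0 //.
exact: sup_norm_ge_coord.
Qed.

Lemma gauge_continuous : continuous N.
Proof.
have [C C0 NC] := gauge_le_sup_norm; apply: (lipschitz_continuous C0) => x y.
apply: le_trans (NC _).
have := gauge_triangle y x 0; have := gauge_triangle x y 0; rewrite !subr0 (gauge_distC y x).
by rewrite ler_norml => *; apply/andP; split; lra.
Qed.

(** Equivalence of norms: the continuous [N] attains a positive minimum on the compact unit sphere
    of the sup norm. *)
Lemma sup_norm_le_gauge : exists2 C, 0 < C & forall x, `|x| <= C * N x.
Proof.
pose S := [set x : 'rV[R]_m | `|x| = 1].
have [[x0 Sx0]|S0] := pselect (S !=set0); last first.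
  (* An empty unit sphere means that the space is trivial. *)
  exists 1 => // x; rewrite mul1r.
  have [->|x0] := eqVneq x 0; first by rewrite normr0 gauge_ge0.
  exfalso; apply: S0; exists (`|x|^-1 *: x).
  by rewrite /S /= normrZ normfV normr_id mulVf // normr_eq0.
have cS : compact S.
  apply: bounded_closed_compact.
    exists 1; split; first exact: num_real.
    by move=> M M1 x /= ->; exact: ltW.
  apply: (@preimage_closed _ _ (fun x : 'rV[R]_m => `|x|) [set 1]).
    by move=> x _; exact: norm_continuous.
  exact/accessible_closed_set1/hausdorff_accessible/Rhausdorff.
have [|c /set_mem Sc cmin] := EVT_min_rV (ex_intro _ _ Sx0) cS (_ : {within S, continuous N}).
  by apply: continuous_subspaceT => x; exact: gauge_continuous.
have Nc0 : 0 < N c.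
  rewrite lt_neqAle gauge_ge0 andbT eq_sym; apply/eqP => Nc; case: HN => _ _ /(_ _ Nc) c0.
  by move: Sc; rewrite /S /= c0 normr0 => /esym/eqP; rewrite oner_eq0.
exists (N c)^-1; first by rewrite invr_gt0.
move=> x; have [->|x0n] := eqVneq x 0.
  by rewrite normr0 gauge0 mulr0.
have nx : 0 < `|x| by rewrite normr_gt0.
have := cmin (`|x|^-1 *: x); rewrite NZ normfV normr_id mulrC => h.
rewrite ler_pdivlMl // -ler_pdivlMr //; apply: h; apply/mem_set.
by rewrite /S /= normrZ normfV normr_id mulVf // normr_eq0.
Qed.

Lemma dot_le_dual_norm (y x : 'rV[R]_m) : dot y x <= dual_norm N y * N x.
Proof.
have [C C0 NC] := sup_norm_le_gauge.
have [Nx0|Nx] := eqVneq (N x) 0.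
  case: HN => _ _ /(_ _ Nx0) ->; rewrite gauge0 mulr0 /dot big1 // => k _.
  by rewrite mxE mulr0.
have Nx0 : 0 < N x by rewrite lt_neqAle gauge_ge0 eq_sym Nx.
rewrite -ler_pdivrMr // mulrC -dotZ; apply: sup_upper_bound.
  (* A real [sup] dominates its set only if the set is bounded above; the bound comes from the
     equivalence of norms. *)
  split; first by exists (dot y 0); exists 0 => //=; rewrite gauge0.
  exists ((\sum_k `|y ord0 k|) * C) => _ [z /= Nz <-].
  apply: le_trans (dot_le_sup_norm _ _) _; rewrite ler_wpM2l ?sumr_ge0 //.
  by apply: le_trans (NC z) _; rewrite ler_piMr // ltW.
exists ((N x)^-1 *: x) => //=.
by rewrite NZ normfV ger0_norm ?(ltW Nx0) // mulVf.
Qed.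
End Norm.

(** * The mirror map *)

Lemma convex_setP {R : realType} {m : nat} (X : set 'rV[R]_m) x y (t : R) :
  convex_set X -> X x -> X y -> 0 <= t <= 1 -> X (t *: x + (1 - t) *: y).
Proof.
move=> cX Xx Xy /andP[t0 t1].
have t01 : 0 <= t <= 1 by rewrite t0.
have /set_mem := cX x y (Itv01 t0 t1) (mem_set Xx) (mem_set Xy).
by [].
Qed.

Lemma convex_functionP {R : realType} {m : nat} (X : set 'rV[R]_m) (h : 'rV[R]_m -> R)
    x y (t : R) :
  convex_function X h -> X x -> X y -> 0 <= t <= 1 ->
  h (t *: x + (1 - t) *: y) <= t * h x + (1 - t) * h y.
Proof.
move=> ch Xx Xy /andP[t0 t1].
exact: (ch (Itv01 t0 t1) x y (mem_set Xx) (mem_set Xy)).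
Qed.

(* Locked: unification otherwise unfolds the differential when it compares its
   values at two distinct points. *)
HB.lock Definition grad_pair {R : realType} {m : nat} (psi : 'rV[R]_m -> R)
  (p h : 'rV[R]_m) : R := 'd psi p h.

Section GradientPairing.
Context {R : realType} {m : nat}.
Implicit Types (psi : 'rV[R]_m -> R) (p x z h : 'rV[R]_m).

Lemma bregmanE psi x p : bregman psi x p = psi x - psi p - grad_pair psi p (x - p).
Proof. by rewrite grad_pair.unlock. Qed.

Lemma grad_pairB psi p x z : grad_pair psi p (x - z) = grad_pair psi p x - grad_pair psi p z.
Proof. by rewrite grad_pair.unlock linearB. Qed.

Lemma grad_pairD psi p x z : grad_pair psi p (x + z) = grad_pair psi p x + grad_pair psi p z.
Proof. by rewrite grad_pair.unlock linearD. Qed.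

Lemma grad_pairZ psi p (a : R) x : grad_pair psi p (a *: x) = a * grad_pair psi p x.
Proof. by rewrite grad_pair.unlock linearZ. Qed.

Lemma grad_pair_continuous psi p : differentiable psi p -> continuous (grad_pair psi p).
Proof. by rewrite grad_pair.unlock; exact: diff_continuous. Qed.

(** For [h = x - p] with both points in a convex [X], these quotients evaluate [psi] on [X] only.
    They give the first-order inequalities as well as the measurability of the gradient pairing. *)
Lemma diff_quotient_cvg psi p h :
  differentiable psi p ->
  (fun k : nat => k.+1%:R * (psi (p + k.+1%:R^-1 *: h) - psi p)) @ \oo --> grad_pair psi p h.
Proof.
rewrite grad_pair.unlock.
move=> dp; have := @diff_derivable _ _ _ psi p h dp; rewrite -(deriveE h dp) => /cvg_ex[l dl].
have -> : 'D_h psi p = l by exact: cvg_lim.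
have h0 : (fun k : nat => k.+1%:R^-1 : R) @ \oo --> (0 : R)^'.
  move=> A nA; have {}nA : nbhs (0 : R) [set z : R | z != 0 -> A z] := nA.
  have : \forall k \near \oo, (k.+1%:R^-1 : R) != 0 -> A k.+1%:R^-1 := cvg_harmonic nA.
  by apply: filterS => k; apply; rewrite invr_neq0 // pnatr_eq0.
have := cvg_comp _ _ h0 dl; apply: cvg_trans; apply: near_eq_cvg; apply: nearW => k /=.
by rewrite invrK /= [_ *: _ + p]addrC.
Qed.

Lemma bregmanxx psi p : bregman psi p p = 0.
Proof. by rewrite bregmanE grad_pairB !subrr. Qed.

Lemma bregman_three_point psi x v p :
  bregman psi x v - bregman psi x p - bregman psi p v =
  grad_pair psi p (x - p) - grad_pair psi v (x - p).
Proof. by rewrite !bregmanE !grad_pairB; lra. Qed.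
End GradientPairing.

Lemma convex_segment {R : realType} {m : nat} (X : set 'rV[R]_m) p x k :
  convex_set X -> X p -> X x ->
  X (p + k.+1%:R^-1 *: (x - p)).
Proof.
move=> convX Xp Xx; have := @convex_setP _ _ X x p (k.+1%:R^-1) convX Xx Xp.
have -> : k.+1%:R^-1 *: x + (1 - k.+1%:R^-1) *: p = p + k.+1%:R^-1 *: (x - p).
  by rewrite scalerBl scale1r scalerBr addrCA addrA.
by apply; rewrite invr_ge0 ler0n invf_le1 ?ler1n ?ltr0n.
Qed.

Section Mirror.
Context {R : realType} {m : nat}.
Variables (N psi : 'rV[R]_m -> R) (X : set 'rV[R]_m).
Hypotheses (HN : is_norm N) (X0 : X !=set0) (cX : compact X) (convX : convex_set X).
Hypothesis dpsi : forall p, X p -> differentiable psi p.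
Hypothesis scpsi : strongly_convex1 N X psi.

(** Strong convexity at the combination of weight t = 1/(k+1), divided by t, in the limit of large
    k. *)
Lemma bregman_ge x p : X x -> X p -> N (x - p) ^+ 2 / 2 <= bregman psi x p.
Proof.
move=> Xx Xp.
have h := diff_quotient_cvg (h := x - p) (dpsi Xp).
have h1 : (fun k : nat => (1 - k.+1%:R^-1) * (N (x - p) ^+ 2 / 2) : R) @ \oo --> N (x - p) ^+ 2 / 2.
  rewrite -[X in _ --> X]mul1r; apply: cvgMl.
  rewrite -[X in _ --> X]subr0; apply: cvgB; [exact: cvg_cst|exact: cvg_harmonic].
have := cvgD h h1; rewrite bregmanE => hc.
suff : grad_pair psi p (x - p) + N (x - p) ^+ 2 / 2 <= psi x - psi p by lra.
apply: (cvgr_to_le (hc _)); apply: nearW => k /=.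
rewrite fctE.
set t := k.+1%:R^-1.
have tk : k.+1%:R * t = 1 by rewrite mulfV // pnatr_eq0.
have t01 : 0 <= t <= 1 by rewrite invr_ge0 ler0n invf_le1 ?ler1n ?ltr0n.
have := scpsi Xx Xp t01.
have -> : t *: x + (1 - t) *: p = p + t *: (x - p).
  by rewrite scalerBl scale1r scalerBr addrCA addrA.
move=> sc.
have k0 : 0 <= k.+1%:R :> R by rewrite ler0n.
have := ler_wpM2l k0 sc.
set q := psi (_ + _); set M := N _ ^+ 2.
have -> : k.+1%:R * (t * psi x + (1 - t) * psi p - t * (1 - t) * M / 2) =
  (k.+1%:R * t) * (psi x - psi p - (1 - t) * M / 2) + k.+1%:R * psi p by ring.
by rewrite tk; lra.
Qed.

Lemma bregman_ge0 x p : X x -> X p -> 0 <= bregman psi x p.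
Proof.
by move=> Xx Xp; apply: le_trans (bregman_ge Xx Xp); rewrite divr_ge0 ?sqr_ge0 ?ler0n.
Qed.

Lemma mirror_objective_continuous (v y : 'rV[R]_m) : X v ->
  {in X, continuous (fun x' : 'rV[R]_m => dot y (v - x') + bregman psi x' v)}.
Proof.
move=> Xv x /set_mem Xx.
apply: (@continuousD _ _ 'rV[R]_m (fun x' => dot y (v - x')) (fun x' => bregman psi x' v)).
  apply: (@lipschitz_continuous _ _ _ (1 + \sum_k `|y ord0 k|)).
    by rewrite ltr_pwDl // sumr_ge0.
  move=> a b; apply: le_trans (dist_dot_le y (v - a) (v - b)) _.
  have -> : v - a - (v - b) = b - a by rewrite opprB addrC addrA subrK.
  by rewrite distrC.
have -> : bregman psi^~ v = (fun x' => psi x' - psi v) - (fun x' => grad_pair psi v (x' - v)).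
  by apply/funext => x'; rewrite bregmanE.
apply: (@continuousB _ _ 'rV[R]_m (fun x' => psi x' - psi v) (fun x' => grad_pair psi v (x' - v))).
  apply: (@continuousB _ _ 'rV[R]_m psi (fun=> psi v)).
    exact: (differentiable_continuous (dpsi Xx)).
  exact: cst_continuous.
apply: (@continuous_comp 'rV[R]_m 'rV[R]_m _ (fun x' => x' - v) (grad_pair psi v)).
  apply: (@continuousB _ _ 'rV[R]_m id (fun=> v)) => //; exact: cst_continuous.
exact: (grad_pair_continuous (dpsi Xv)).
Qed.

Lemma mirror_map_argmin v y : X v ->
  argmin X (fun x' : 'rV[R]_m => dot y (v - x') + bregman psi x' v) (mirror_map X psi v y).
Proof.
move=> Xv; rewrite /mirror_map.
have [|c /set_mem Xc cmin] := EVT_min_rV X0 cX (_ : {within X,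
    continuous (fun x' : 'rV[R]_m => dot y (v - x') + bregman psi x' v)}).
  by apply: continuous_in_subspaceT; exact: mirror_objective_continuous.
apply: (@getPex _ (argmin X (fun x' : 'rV[R]_m => dot y (v - x') + bregman psi x' v))).
by exists c; split => // z Xz; apply: cmin; exact/mem_set.
Qed.

(* First-order optimality of [xp] over [X]: by [bregman_three_point] the right-hand
   side is the pairing of [x - xp] with [grad psi xp - grad psi v]. *)
Lemma mirror_three_point v y x : X v -> X x ->
  let xp := mirror_map X psi v y in
  dot y (x - xp) <= bregman psi x v - bregman psi x xp - bregman psi xp v.
Proof.
move=> Xv Xx /=; set xp := mirror_map X psi v y.
have [Xxp xpmin] := mirror_map_argmin y Xv; rewrite -/xp in Xxp xpmin.
suff : dot y (x - xp) + grad_pair psi v (x - xp) <= grad_pair psi xp (x - xp).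
  by rewrite bregman_three_point; lra.
apply: (cvgr_to_ge (diff_quotient_cvg (h := x - xp) (dpsi Xxp))); apply: nearW => k.
have h := xpmin _ (convex_segment k convX Xxp Xx).
set t := k.+1%:R^-1 in h *; set z := x - xp in h *.
have tk : k.+1%:R * t = 1 by rewrite mulfV // pnatr_eq0.
rewrite !bregmanE !grad_pairB grad_pairD grad_pairZ !dotB dotD dotZ in h.
have k0 : 0 <= k.+1%:R :> R by rewrite ler0n.
have := ler_wpM2l k0 h.
move: (psi (xp + _)) (grad_pair psi v z) (dot y z) (grad_pair psi v xp) (grad_pair psi v v) => a b c e f.
have e1 : k.+1%:R * (t * b) = b by rewrite mulrA tk mul1r.
have e2 : k.+1%:R * (t * c) = c by rewrite mulrA tk mul1r.
by rewrite !(mulrDr, mulrBr, mulrN); lra.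
Qed.

(** Quadratic growth of the objective at its minimizer: near-minimal values force nearby points,
    which is what makes the minimizer measurable. *)
Lemma mirror_objective_gap v y x : X v -> X x ->
  let xp := mirror_map X psi v y in
  N (x - xp) ^+ 2 / 2 <=
  (dot y (v - x) + bregman psi x v) - (dot y (v - xp) + bregman psi xp v).
Proof.
move=> Xv Xx /=; set xp := mirror_map X psi v y; have [Xxp _] := mirror_map_argmin y Xv.
have := mirror_three_point y Xv Xx; have := bregman_ge Xx Xxp; rewrite -/xp.
by rewrite /= !dotB; lra.
Qed.
End Mirror.

(** * Measurability *)

Lemma ex_invn_lt {R : realType} (e : R) : 0 < e -> exists n : nat, n.+1%:R^-1 < e.
Proof.
move=> e0; have [n _ hn] := near_infty_natSinv_lt (PosNum e0).
by exists n; exact: (hn n (leqnn n)).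
Qed.

(** [X] may contain no rational point. For every rational centre and radius 1/(n+1), a point of [X]
    in that ball is chosen if there is one, and [x0] otherwise. *)
Lemma dense_sequence {R : realType} {m : nat} (X : set 'rV[R]_m) : X !=set0 ->
  exists q : nat -> 'rV[R]_m, (forall k, X (q k)) /\
    forall z e, X z -> 0 < e -> exists k, `|z - q k| < e.
Proof.
move=> [x0 Xx0].
pose A (rn : 'rV[rat]_m * nat) := X `&` [set p | `|p - map_mx ratr rn.1| < rn.2.+1%:R^-1].
pose pt rn := xget x0 (A rn).
have Xpt rn : X (pt rn).
  by rewrite /pt; case: xgetP => // y _ [].
exists (fun k => if unpickle k is Some rn then pt rn else x0); split.
  by move=> k; case: unpickle.
move=> z e Xz e0.
have [n ne] : exists n : nat, n.+1%:R^-1 < e / 2.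
  by apply: ex_invn_lt; rewrite divr_gt0.
have n0 : 0 < n.+1%:R^-1 :> R by rewrite invr_gt0 ltr0n.
have [r rz] : exists r : 'rV[rat]_m, `|z - map_mx ratr r| < n.+1%:R^-1.
  have ex k : exists r : rat, `|z ord0 k - ratr r| < n.+1%:R^-1.
    move: n.+1%:R^-1 n0 => dl dl0.
    have : z ord0 k - dl < z ord0 k + dl by lra.
    move=> /rat_in_itvoo[r]; rewrite in_itv /= => /andP[h1 h2].
    by exists r; rewrite ltr_norml; apply/andP; split; lra.
  have [r rP] := choice ex.
  exists (\row_k r k); rewrite [X in X < _]/Num.norm /= mx_normrE.
  apply: bigmax_lt => // -[i k] _ /=; rewrite !mxE (ord1 i); exact: rP.
exists (pickle (r, n)); rewrite pickleK.
have : A (r, n) (pt (r, n)) by apply: (xgetPex _ (ex_intro _ z (conj Xz rz))).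
move=> [_ /= h].
rewrite -(subrKA (map_mx ratr r)); apply: le_lt_trans (ler_normD _ _) _.
rewrite distrC in h; apply: lt_le_trans (ltrD rz h) _.
by rewrite [leRHS]splitr lerD // ltW.
Qed.

Section Measurability.
Context {R : realType} {d : measure_display} {T : measurableType d}.

Lemma measurable_lt_set (u : T -> R) a : measurable_fun setT u ->
  measurable [set o | u o < a].
Proof.
move=> mu; have := mu measurableT _ (measurable_itv `]-oo, a[).
by rewrite setTI; congr measurable; apply/seteqP; split => o /=; rewrite in_itv.
Qed.

Lemma measurable_fun_gt_sets (u : T -> R) :
  (forall a, measurable [set o | a < u o]) -> measurable_fun setT u.
Proof.
move=> mu; apply: (measurability _ (RGenOInfty.measurableE R)) => //.
move=> _ [_ [a ->] <-]; rewrite setTI.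
have -> : u @^-1` `]a, +oo[%classic = [set o | a < u o].
  by apply/seteqP; split => o /=; rewrite in_itv /= andbT.
exact: mu.
Qed.

Lemma measurable_fun_ge_sets (u : T -> R) :
  (forall a, measurable [set o | a <= u o]) -> measurable_fun setT u.
Proof.
move=> mu; apply: (measurability _ (RGenCInfty.measurableE R)) => //.
move=> _ [_ [a ->] <-]; rewrite setTI.
have -> : u @^-1` `[a, +oo[%classic = [set o | a <= u o].
  by apply/seteqP; split => o /=; rewrite in_itv /= andbT.
exact: mu.
Qed.

(* [close e k o] says that the [k]-th point of a dense sequence is [e]-close to
   the random point at [o], [H k] is the value at the former and [u o] at the latter. *)
Lemma measurable_fun_dense (u : T -> R) (H : nat -> R) (close : R -> nat -> set T) :
  (forall e k, measurable (close e k)) ->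
  (forall e e' k, e <= e' -> close e k `<=` close e' k) ->
  (forall e o, 0 < e -> exists k, close e k o) ->
  (forall e o, 0 < e -> exists2 e', 0 < e' & forall k, close e' k o -> `|H k - u o| < e) ->
  measurable_fun setT u.
Proof.
move=> mc cmono cdense ccont; apply: measurable_fun_gt_sets => a.
(* Only [close] depends on [o] on the right: [u o] exceeds [a] exactly when, for some [n], every
   dense point closer than the tolerance 1/(n+1) has a value above a + 1/(n+1). *)
have -> : [set o | a < u o] =
    \bigcup_n \bigcap_(k in [set k | H k <= a + n.+1%:R^-1]) ~` close n.+1%:R^-1 k.
  apply/seteqP; split => o /= h.
    have e0 : 0 < (u o - a) / 2 by rewrite divr_gt0 ?subr_gt0.
    have [e' e'0 ce'] := ccont _ o e0.
    have /ex_invn_lt[n] : 0 < Num.min e' ((u o - a) / 2).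
      by rewrite lt_min e'0.
    rewrite lt_min => /andP[h1 h2].
    exists n => // k /= Hk ck; have := ce' k (cmono _ _ _ (ltW h1) _ ck).
    by rewrite ltr_norml => /andP[]; move: h2 Hk; move: n.+1%:R^-1 => dn; lra.
  have [n _ hn] := h.
  have n0 : 0 < n.+1%:R^-1 :> R by rewrite invr_gt0 ltr0n.
  have [e' e'0 ce'] := ccont _ o n0.
  have [|k ck] := cdense (Num.min e' n.+1%:R^-1) o; first by rewrite lt_min e'0.
  have ck1 : close e' k o by apply: cmono ck; rewrite ge_min lexx.
  have ck2 : close n.+1%:R^-1 k o by apply: cmono ck; rewrite ge_min lexx orbT.
  have := ce' _ ck1; rewrite ltr_norml => /andP[h1 h2].
  rewrite ltNge; apply/negP => ua; apply: (hn k) => //=.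
  by move: h1 h2; move: n.+1%:R^-1 => dn; lra.
apply: bigcup_measurable => n _; apply: bigcap_measurableType => k _.
exact/measurableC/mc.
Qed.

Context {m : nat}.
Implicit Type z : T -> 'rV[R]_m.

Definition measurable_vec z := forall k, measurable_fun setT (fun o => z o ord0 k).

Lemma measurable_vec_cst p : measurable_vec (fun=> p).
Proof. by move=> k; exact: measurable_cst. Qed.

Lemma measurable_vec_sum n (a : 'I_n -> R) (z : 'I_n -> T -> 'rV[R]_m) :
  (forall j, measurable_vec (z j)) -> measurable_vec (fun o => \sum_j a j *: z j o).
Proof.
move=> mz k; under eq_fun do rewrite summxE.
apply: measurable_sum => j; under eq_fun do rewrite mxE.
by apply: measurable_funM => //; exact: mz.
Qed.

Lemma measurable_dot z z' : measurable_vec z -> measurable_vec z' ->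
  measurable_fun setT (fun o => dot (z o) (z' o)).
Proof.
by move=> mz mz'; apply: measurable_sum => k; apply: measurable_funM; [exact: mz|exact: mz'].
Qed.

Lemma measurable_sup_dist z p : measurable_vec z ->
  measurable_fun setT (fun o => `|z o - p|).
Proof.
move=> mz.
have -> : (fun o => `|z o - p|) = (fun o => \big[Num.max/0]_ij `|(z o - p) ij.1 ij.2|).
  by apply/funext => o; rewrite -mx_normrE.
elim: (index_enum _) => [|ij s IH].
  by under eq_fun do rewrite big_nil; exact: measurable_cst.
under eq_fun do rewrite big_cons.
apply: measurable_maxr => //.
apply: measurableT_comp => //; under eq_fun do rewrite !mxE (ord1 ij.1).
by apply: measurable_funB => //; exact: mz.
Qed.

Lemma measurable_continuous_comp (X : set 'rV[R]_m) (h : 'rV[R]_m -> R) z :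
  (forall o, X (z o)) -> measurable_vec z -> {in X, continuous h} ->
  measurable_fun setT (fun o => h (z o)).
Proof.
move=> Xz mz ch.
have [q [Xq dq]] := dense_sequence (ex_intro _ _ (Xz point)).
apply: (@measurable_fun_dense _ (h \o q) (fun e k => [set o | `|z o - q k| < e])).
- by move=> e k; apply: measurable_lt_set; exact: measurable_sup_dist.
- by move=> e e' k ee' o /= /lt_le_trans; apply.
- by move=> e o e0; exact: dq.
move=> e o e0; have /cvgrPdist_lt /(_ e e0) /nbhs_normP[e' /= e'0 he'] := ch _ (mem_set (Xz o)).
by exists e' => // k /= ck; rewrite distrC; exact: he'.
Qed.

(** By quadratic growth, a lower bound on a coordinate of [z] can be tested on dense points that are
    almost minimal among the dense points: countably many conditions on the measurable functions
    [G p]. *)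
Lemma measurable_argmin (X : set 'rV[R]_m) (G : 'rV[R]_m -> T -> R) z (C : R) :
  0 < C -> (forall o, X (z o)) -> (forall p, X p -> measurable_fun setT (G p)) ->
  (forall p o, X p -> `|p - z o| ^+ 2 <= C * (G p o - G (z o) o)) ->
  (forall o, {in X, continuous (G^~ o)}) -> measurable_vec z.
Proof.
move=> C0 Xz mG gap cG j; apply: measurable_fun_ge_sets => a.
have [q [Xq dq]] := dense_sequence (ex_intro _ _ (Xz point)).
have near_z o e : 0 < e -> exists k, `|z o - q k| < e /\ G (q k) o < G (z o) o + e.
  move=> e0; have /cvgrPdist_lt /(_ e e0) /nbhs_normP[e' /= e'0 he'] := cG o _ (mem_set (Xz o)).
  have [|k hk] := dq (z o) (Num.min e e') (Xz o); first by rewrite lt_min e0.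
  move: hk; rewrite lt_min => /andP[h1 h2]; exists k; split=> //.
  by have := he' _ h2; rewrite /= ltr_norml => /andP[]; lra.
have zmin o p : X p -> G (z o) o <= G p o.
  move=> Xp; have := gap p o Xp; have := sqr_ge0 `|p - z o| => h1 h2.
  have := le_trans h1 h2; rewrite pmulr_rge0 //; lra.
have -> : [set o | a <= z o ord0 j] =
    \bigcap_n \bigcup_(k in [set k | a - n.+1%:R^-1 < q k ord0 j])
      \bigcap_k' [set o | G (q k) o < G (q k') o + n.+1%:R^-1].
  apply/seteqP; split => o /= h.
    move=> n _; have n0 : 0 < n.+1%:R^-1 :> R by rewrite invr_gt0 ltr0n.
    have [k [h1 h2]] := near_z o _ n0; exists k => /=.
      have := le_lt_trans (sup_norm_ge_coord _ j) h1; rewrite !mxE ltr_norml => /andP[].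
      by move: h; move: n.+1%:R^-1 => dn; lra.
    move=> k' _ /=; have := zmin o _ (Xq k').
    by move: h2; move: n.+1%:R^-1 => dn; lra.
  rewrite leNgt; apply/negP => za.
  pose e := a - z o ord0 j; have e0 : 0 < e by rewrite subr_gt0.
  (* At this precision coordinate [j] of the dense point is at least [e / 2] away from that of
     [z o], while quadratic growth keeps the squared distance below [e ^+ 2 / 8], less than
     [(e / 2) ^+ 2]. *)
  have /ex_invn_lt[n] : 0 < Num.min (e / 2) (e ^+ 2 / (8 * C)).
    by rewrite lt_min !divr_gt0 ?exprn_gt0 ?mulr_gt0 ?ltr0n.
  rewrite lt_min => /andP[n1 n2].
  have n0 : 0 < n.+1%:R^-1 :> R by rewrite invr_gt0 ltr0n.
  have [k /= qk hk] := h n I.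
  have Gk : G (q k) o <= G (z o) o + n.+1%:R^-1.
    apply/ler_addgt0Pr => e1 e10; have [k' [_ h2]] := near_z o e1 e10.
    by have := hk k' I; rewrite /=; move: h2; move: n.+1%:R^-1 => dn; lra.
  have := gap (q k) o (Xq k).
  have : C * (G (q k) o - G (z o) o) <= C * n.+1%:R^-1 by rewrite ler_wpM2l ?(ltW C0) // lerBlDl.
  have : C * n.+1%:R^-1 < e ^+ 2 / 8.
    rewrite -ltr_pdivlMl // (_ : C^-1 * _ = e ^+ 2 / (8 * C)) //; field.
    by rewrite gt_eqF.
  have : (e / 2) ^+ 2 <= `|q k - z o| ^+ 2.
    rewrite lerXn2r ?nnegrE //; first by rewrite divr_ge0 // ltW.
    apply: le_trans (sup_norm_ge_coord _ j); rewrite !mxE.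
    by apply: le_trans (ler_norm _);  move: n1 qk; rewrite /e; move: n.+1%:R^-1 => dn; lra.
  have := exprn_gt0 2 e0.
  move=> e2 p1 p2 p3 p4; have := le_lt_trans (le_trans p1 (le_trans p4 p3)) p2.
  have -> : (e / 2) ^+ 2 = e ^+ 2 / 4 by field.
  by move: (e ^+ 2) e2 => e2' *; lra.
apply: bigcap_measurableType => n _; apply: bigcup_measurable => k _.
apply: bigcap_measurableType => k' _.
have := @measurable_lt_set (fun o => G (q k) o - G (q k') o) n.+1%:R^-1
  (measurable_funB (mG _ (Xq k)) (mG _ (Xq k'))).
by congr measurable; apply/seteqP; split => o /=; move: n.+1%:R^-1 => dn; lra.
Qed.
End Measurability.

(** * Integrals and conditional expectations *)

Section Expectation.
Context {R : realType} {d : measure_display} {T : measurableType d} (P : probability T R).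
Implicit Types (Y Z h : T -> R).

Definition integrable_fun Y := P.-integrable setT (EFin \o Y).

Local Notation intg := integrable_fun.

Lemma intgD Y Z : intg Y -> intg Z -> intg (fun o => Y o + Z o).
Proof. by move=> iY iZ; have := integrableD measurableT iY iZ; apply: eq_integrable. Qed.

Lemma intgB Y Z : intg Y -> intg Z -> intg (fun o => Y o - Z o).
Proof. by move=> iY iZ; have := integrableB measurableT iY iZ; apply: eq_integrable. Qed.

Lemma intgZ a Y : intg Y -> intg (fun o => a * Y o).
Proof. by move=> iY; have := integrableZl measurableT a iY; apply: eq_integrable. Qed.

Lemma intg_sum (I : Type) (s : seq I) (Y : I -> T -> R) :
  (forall i, intg (Y i)) -> intg (fun o => \sum_(i <- s) Y i o).
Proof.
move=> iY; have := @integrable_sum _ _ _ P _ measurableT _ s xpredT (fun i => EFin \o Y i) (fun i _ => iY i).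
by apply: eq_integrable => // o _ /=; rewrite sumEFin.
Qed.

Lemma intg_bounded Y M : measurable_fun setT Y -> (forall o, `|Y o| <= M) -> intg Y.
Proof.
move=> mY bY; apply: measurable_bounded_integrable => //.
  by apply: le_lt_trans (probability_le1 P measurableT) _; exact: ltry.
by exists M; split => [|x Mx o _ /=]; [exact: num_real|exact: le_trans (bY o) (ltW Mx)].
Qed.

Lemma intg_cst c : intg (fun=> c).
Proof. by apply: (@intg_bounded _ `|c|) => //; exact: measurable_cst. Qed.

Lemma intgM_bounded h Y M : measurable_fun setT h -> (forall o, `|h o| <= M) ->
  intg Y -> intg (fun o => h o * Y o).
Proof.
move=> mh bh iY; have := @integrableMr _ _ _ P _ measurableT h (EFin \o Y) mh _ iY.
apply => //.
by exists M; split => [|x Mx o _ /=]; [exact: num_real|exact: le_trans (bh o) (ltW Mx)].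
Qed.

Lemma Rint_sum (I : Type) (s : seq I) (Y : I -> T -> R) : (forall i, intg (Y i)) ->
  \int[P]_o (\sum_(i <- s) Y i o) = \sum_(i <- s) \int[P]_o Y i o.
Proof.
move=> iY; elim: s => [|i s IH].
  by under eq_Rintegral do rewrite big_nil; rewrite big_nil Rintegral_cst // mul0r.
under eq_Rintegral do rewrite big_cons.
by rewrite big_cons RintegralD // ?IH //; [exact: iY|exact: intg_sum].
Qed.

Lemma Rint_cst c : \int[P]_o c = c.
Proof. 
rewrite Rintegral_cst // -[RHS]mulr1; congr (c * _).
exact: (congr1 fine (probability_setT P)).
 Qed.

Lemma expectationE Y : intg Y -> ('E_P[Y] = (\int[P]_o Y o)%R%:E)%E.
Proof. by move=> iY; rewrite unlock /Rintegral fineK //; exact: integrable_fin_num. Qed.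

(** Integrability travels with the bound, because real integrals are additive and monotone for
    integrable functions; pathwise bounds can then be averaged term by term. *)
Definition mean_le Y c := intg Y /\ \int[P]_o Y o <= c.

Lemma mean_le_cst c : mean_le (fun=> c) c.
Proof. by split; [exact: intg_cst|rewrite Rint_cst]. Qed.

Lemma mean_leW Y c c' : c <= c' -> mean_le Y c -> mean_le Y c'.
Proof. by move=> cc' [iY Yc]; split => //; exact: le_trans cc'. Qed.

Lemma mean_le_le Y Z c : intg Y -> (forall o, Y o <= Z o) -> mean_le Z c -> mean_le Y c.
Proof.
by move=> iY YZ [iZ Zc]; split => //; apply: le_trans Zc; apply: le_Rintegral => // o _; exact: YZ.
Qed.

Lemma mean_leD Y Z c c' : mean_le Y c -> mean_le Z c' -> mean_le (fun o => Y o + Z o) (c + c').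
Proof.
by move=> [iY Yc] [iZ Zc]; split; [exact: intgD|rewrite RintegralD // lerD].
Qed.

Lemma mean_leZ a Y c : 0 <= a -> mean_le Y c -> mean_le (fun o => a * Y o) (a * c).
Proof.
by move=> a0 [iY Yc]; split; [exact: intgZ|rewrite RintegralZl // ler_wpM2l].
Qed.

Lemma mean_le_sum (I : Type) (s : seq I) (Y : I -> T -> R) (c : I -> R) :
  (forall i, mean_le (Y i) (c i)) ->
  mean_le (fun o => \sum_(i <- s) Y i o) (\sum_(i <- s) c i).
Proof.
move=> Yc; split; first by apply: intg_sum => i; case: (Yc i).
rewrite Rint_sum => [|i]; last by case: (Yc i).
by apply: ler_sum => i _; case: (Yc i).
Qed.

(* The bounded function [h] is replaced by a step function taking finitely many
   values, constant on members of [G], up to a uniform error [1/N]. *)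
Lemma cond_expectation_orthogonal (G : set (set T)) Y Z h M :
  G `<=` measurable -> is_cond_expectation P G Y Z -> sub_measurable G h ->
  (forall o, `|h o| <= M) ->
  intg (fun o => h o * (Z o - Y o)) /\ \int[P]_o (h o * (Z o - Y o)) = 0.
Proof.
move=> Gm [iY iZ _ condE] Gh bh.
have mh : measurable_fun setT h by move=> _ B mB; rewrite setTI; apply: Gm; exact: Gh.
pose D o := Z o - Y o.
have iD : intg D by exact: intgB.
have ihD : intg (fun o => h o * D o) by exact: (intgM_bounded mh bh).
split; first exact: ihD.
have intA A : G A -> \int[P]_o ((\1_A o : R) * D o) = 0.
  move=> GA; have mA := Gm A GA.
  have -> : \int[P]_o ((\1_A o : R) * D o) = \int[P]_(o in A) D o.
    rewrite [RHS]Rintegral_mkcond; congr Rintegral; apply/funext => o.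
    by rewrite indicE patchE; case: ifP => _; rewrite ?mul1r ?mul0r.
  have sub f : P.-integrable setT (EFin \o f) -> P.-integrable A (EFin \o f).
    exact: (integrableS measurableT mA (@subsetT _ A)).
  by rewrite /D RintegralB ?sub // condE // subrr.
have iabs : intg (fun o => `|D o|) by exact: integrable_norm.
have approx (n : nat) : `|\int[P]_o (h o * D o)| <= n.+1%:R^-1 * \int[P]_o `|D o|.
  have : 0 < n.+1%:R :> R by rewrite ltr0n.
  move: n.+1%:R => N N0.
  pose A k := h @^-1` `[k%:R / N - M, k.+1%:R / N - M[%classic.
  (* [(h o + M) * N] lies between 0 and [2 * M * N], so [K] cells of width [1 / N] cover the range
     of [h]. *)
  pose K := (Num.truncn (2 * M * N)).+1.
  pose s o : R := \sum_(k < K) (k%:R / N - M) * \1_(A k) o.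
  have GA k : G (A k) by apply: Gh; exact: measurable_itv.
  have sh o : `|h o - s o| <= N^-1.
    have h0 : 0 <= (h o + M) * N.
      by rewrite mulr_ge0 ?(ltW N0) //; have := bh o; rewrite ler_norml => /andP[]; lra.
    pose k0 := Num.truncn ((h o + M) * N).
    have /andP[k1 k2] := truncn_itv h0; rewrite -/k0 in k1 k2.
    have k0K : (k0 < K)%N.
      rewrite ltnS; apply: le_truncn; rewrite ler_wpM2r ?(ltW N0) //.
      by have := bh o; rewrite ler_norml => /andP[]; lra.
    have Ak k : (o \in A k) = (k == k0).
      apply/idP/eqP => [/set_mem|->].
        rewrite /A /= in_itv /= => /andP[a1 a2].
        have b1 : k%:R <= (h o + M) * N by rewrite -ler_pdivrMr // -lerBlDr.
        have b2 : (h o + M) * N < k.+1%:R by rewrite -ltr_pdivlMr // -ltrBrDr.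
        by apply/esym/truncn_def; rewrite b1 b2.
      apply/mem_set; rewrite /A /= in_itv /=.
      apply/andP; split; first by rewrite lerBlDr ler_pdivrMr.
      by rewrite ltrBrDr ltr_pdivlMr.
    have -> : s o = k0%:R / N - M.
      rewrite /s (bigD1 (Ordinal k0K)) //= indicE Ak eqxx mulr1 big1 ?addr0 // => k kk0.
      by rewrite indicE Ak (_ : (k == k0 :> nat) = false) ?mulr0 //;
        apply: contraNF kk0 => /eqP kk; apply/eqP/val_inj.
    have : k0%:R / N <= h o + M by rewrite ler_pdivrMr.
    have : h o + M < k0%:R / N + N^-1.
      have -> : k0%:R / N + N^-1 = k0.+1%:R / N by rewrite -natr1 mulrDl mul1r.
      by rewrite ltr_pdivlMr.
    by rewrite ler_norml => *; apply/andP; split; lra.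
  have i1 k : intg (fun o => (\1_(A k) o : R) * D o).
    apply: (@intgM_bounded _ _ 1) => // [|o].
      by apply: measurable_indic; exact: Gm.
    by rewrite indicE; case: (_ \in _); rewrite ?normr1 ?normr0.
  have isD : intg (fun o => s o * D o).
    have -> : (fun o => s o * D o) = (fun o => \sum_(k < K) (k%:R / N - M) * (\1_(A k) o * D o)).
      by apply/funext => o; rewrite mulr_suml; apply: eq_bigr => k _; rewrite mulrA.
    by apply: intg_sum => k; exact: intgZ.
  have s0 : \int[P]_o (s o * D o) = 0.
    have -> : (fun o => s o * D o) = (fun o => \sum_(k < K) (k%:R / N - M) * (\1_(A k) o * D o)).
      by apply/funext => o; rewrite mulr_suml; apply: eq_bigr => k _; rewrite mulrA.
    rewrite Rint_sum => [|k]; last exact: intgZ.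
    by rewrite big1 // => k _; rewrite RintegralZl // ?intA ?mulr0 //; exact: i1.
  have -> : \int[P]_o (h o * D o) = \int[P]_o (h o * D o - s o * D o).
    by rewrite RintegralB // s0 subr0.
  have idiff : intg (fun o => h o * D o - s o * D o) by exact: intgB.
  apply: le_trans (le_normr_Rintegral measurableT idiff) _.
  rewrite -RintegralZl //; apply: le_Rintegral => //.
  - exact: integrable_norm.
  - exact: intgZ.
  - by move=> o _; rewrite -mulrBl normrM ler_wpM2r.
apply/eqP; rewrite -normr_le0 leNgt; apply/negP => e0.
set e := `|_| in approx e0; set I := \int[P]_o `|D o| in approx.
have I0 : 0 <= I by exact: Rintegral_ge0.
(* [I] may vanish, hence the division by [I + 1]. *)
have I1 : 0 < I + 1 by rewrite ltr_wpDl.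
have [n hn] : exists n : nat, n.+1%:R^-1 < e / (I + 1).
  have [n _ hn] := near_infty_natSinv_lt (PosNum (divr_gt0 e0 I1)).
  by exists n; exact: (hn n (leqnn n)).
have := approx n; apply/negP; rewrite -ltNge.
apply: (@le_lt_trans _ _ (n.+1%:R^-1 * (I + 1))).
  by rewrite ler_wpM2l ?invr_ge0 ?ler0n // lerDl.
by rewrite -ltr_pdivlMr.
Qed.
End Expectation.

(** * Perturbed averaging *)

Section PerturbedAveraging.
Context {R : realType} {m n : nat}.
Variables (N : 'rV[R]_m -> R) (HN : is_norm N).
Variables (W : nat -> 'I_n -> 'I_n -> R) (E : nat -> rel 'I_n) (eta : R) (B : nat).
Hypotheses (n0 : (0 < n)%N) (eta01 : 0 < eta < 1).
Hypotheses (W0 : forall t i j, 0 <= W t i j).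
Hypotheses (Eself : forall t i, E t i i).
Hypotheses (WE : forall t i j, E t j i -> eta <= W t i j).
Hypotheses (WnE : forall t i j, ~~ E t j i -> W t i j = 0).
Hypotheses (Wrow : forall t i, \sum_j W t i j = 1).
Hypotheses (Wcol : forall t j, \sum_i W t i j = 1).
Hypothesis B1 : (1 <= B)%N.
Hypothesis conn : jointly_strongly_connected E B.
Variables (x p : nat -> 'I_n -> 'rV[R]_m).
Hypothesis xS : forall t i, x t.+1 i = \sum_j W t i j *: x t j + p t i.

(** Discrete variation of constants: the perturbation of time [s] enters [x s.+1] and is averaged
    from step [s.+1] on. *)
Lemma averaging_unroll t i :
  x t i = \sum_j transition W 0 t i j *: x 0%N j +
    \sum_(s < t) \sum_j transition W s.+1 (t - s.+1) i j *: p s j.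
Proof.
elim: t i => [|t IH] i.
  rewrite big_ord0 addr0 (bigD1 i) //= eqxx scale1r big1 ?addr0 // => j ji.
  by rewrite eq_sym (negbTE ji) scale0r.
rewrite xS big_ord_recr /= addrA; congr (_ + _); last first.
  rewrite subnn (bigD1 i) //= eqxx scale1r big1 ?addr0 // => j ji.
  by rewrite eq_sym (negbTE ji) scale0r.
under eq_bigr do rewrite IH scalerDr.
rewrite big_split /=; congr (_ + _).
  under eq_bigr do rewrite scaler_sumr.
  rewrite exchange_big /=; apply: eq_bigr => j _; rewrite scaler_suml.
  by apply: eq_bigr => k _; rewrite scalerA add0n.
under eq_bigr do rewrite scaler_sumr.
rewrite exchange_big /=; apply: eq_bigr => s _.
under eq_bigr do rewrite scaler_sumr.
rewrite exchange_big /=; apply: eq_bigr => j _.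
rewrite subSn ?ltn_ord //= subnKC ?ltn_ord // scaler_suml.
by apply: eq_bigr => k _; rewrite scalerA.
Qed.

Definition average t : 'rV[R]_m := n%:R^-1 *: \sum_j x t j.

Lemma average_unroll t :
  average t = \sum_j n%:R^-1 *: x 0%N j + \sum_(s < t) \sum_j n%:R^-1 *: p s j.
Proof.
elim: t => [|t IH]; first by rewrite big_ord0 addr0 -scaler_sumr.
rewrite big_ord_recr /= addrA -IH /average -scaler_sumr -scalerDr; congr (_ *: _).
under eq_bigr do rewrite xS.
rewrite big_split exchange_big /=; congr (_ + _).
by apply: eq_bigr => j _; rewrite -scaler_suml Wcol scale1r.
Qed.

(** The two unrolled formulas are subtracted term by term. The uniform bound on [transition] needs
    at least one factor, so the newest perturbation [p t], not yet averaged, is kept apart. *)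
Lemma consensus_error t i :
  N (x t.+1 i - average t.+1) <=
    Gam eta n * theta eta n B ^+ t * \sum_j N (x 0%N j) +
    Gam eta n * \sum_(s < t) theta eta n B ^+ (t - s.+1) * \sum_j N (p s j) +
    (N (p t i) + n%:R^-1 * \sum_j N (p t j)).
Proof.
have [ND NZ _] := HN.
rewrite averaging_unroll average_unroll !big_ord_recr /= !subnn.
set x1 := \sum_j _ *: _; set q1 := \sum_(s < t) _; set r1 := \sum_j (i == j)%:R *: _.
set x2 := \sum_j _ *: _; set q2 := \sum_(s < t) _; set r2 := \sum_j _ *: _.
have -> : x1 + (q1 + r1) - (x2 + (q2 + r2)) = (x1 - x2) + (q1 - q2) + (r1 - r2).
  move: x1 q1 r1 x2 q2 r2 => a b c e f g.
  by rewrite !opprD addrACA (addrACA b) (addrA (a - e)).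
have tr s tau j : `|transition W s tau.+1 i j - n%:R^-1| <= Gam eta n * theta eta n B ^+ tau.
  exact: (transition_near_uniform n0 eta01 W0 Eself WE WnE Wrow Wcol B1 conn).
apply: le_trans (ND _ _) _; apply: lerD; first (apply: le_trans (ND _ _) _; apply: lerD).
- rewrite /x1 /x2 -sumrB; apply: le_trans (gauge_sum HN _ _ _) _.
  rewrite mulr_sumr; apply: ler_sum => j _.
  by rewrite -scalerBl NZ ler_wpM2r ?(gauge_ge0 HN) //; exact: (tr 0%N).
- rewrite /q1 /q2 -sumrB; apply: le_trans (gauge_sum HN _ _ _) _.
  rewrite mulr_sumr; apply: ler_sum => s _.
  rewrite -sumrB; apply: le_trans (gauge_sum HN _ _ _) _.
  rewrite mulrA mulr_sumr; apply: ler_sum => j _.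
  by rewrite -scalerBl NZ subSn ?ltn_ord // ler_wpM2r ?(gauge_ge0 HN) //; exact: tr.
have -> : r1 = p t i.
  rewrite /r1 (bigD1 i) //= eqxx scale1r big1 ?addr0 // => j ji.
  by rewrite eq_sym (negbTE ji) scale0r.
apply: le_trans (ND _ _) _; rewrite lerD2l (gaugeN HN).
apply: le_trans (gauge_sum HN _ _ _) _; rewrite mulr_sumr; apply: ler_sum => j _.
by rewrite NZ ger0_norm // invr_ge0 ler0n.
Qed.
End PerturbedAveraging.

Lemma weighted_telescope {R : realFieldType} (A alpha : nat -> R) (D : R) (K : nat) :
  (forall t, 0 < alpha t) -> (forall t, alpha t.+1 <= alpha t) ->
  (forall t, 0 <= A t <= D) ->
  \sum_(t < K.+1) (A t - A t.+1) / alpha t <= D / alpha K.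
Proof.
move=> a0 anon AD.
(* The induction keeps [- A K.+1]: as [D - A K.+1] is nonnegative, the weight may be raised to the
   next [1 / alpha]. *)
suff : \sum_(t < K.+1) (A t - A t.+1) / alpha t <= (D - A K.+1) / alpha K.
  move=> /le_trans; apply; rewrite ler_wpM2r ?invr_ge0 ?(ltW (a0 _)) //.
  by have /andP[] := AD K.+1; lra.
elim: K => [|K IH].
  rewrite big_ord1 /= ler_wpM2r ?invr_ge0 ?(ltW (a0 _)) //.
  by have /andP[] := AD 0%N; lra.
rewrite big_ord_recr /=; apply: le_trans (lerD IH (lexx _)) _.
have : (D - A K.+1) / alpha K <= (D - A K.+1) / alpha K.+1.
  rewrite ler_wpM2l ?lef_pV2 ?posrE //.
  by have /andP[] := AD K.+1; lra.
by rewrite !mulrBl; lra.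
Qed.

(** Membership and inequality go through the same induction over renormalized partial sums; [h = 0]
    yields membership alone. *)
Lemma jensen {R : realType} {m : nat} (X : set 'rV[R]_m) (h : 'rV[R]_m -> R)
    (I : finType) (p : I -> R) (a : I -> 'rV[R]_m) :
  (forall x y (t : R), X x -> X y -> 0 <= t <= 1 ->
     X (t *: x + (1 - t) *: y) /\ h (t *: x + (1 - t) *: y) <= t * h x + (1 - t) * h y) ->
  (forall i, 0 <= p i) -> \sum_i p i = 1 -> (forall i, X (a i)) ->
  X (\sum_i p i *: a i) /\ h (\sum_i p i *: a i) <= \sum_i p i * h (a i).
Proof.
move=> conv p0 p1 Xa.
suff main (s : seq I) : 0 < \sum_(i <- s) p i ->
    X ((\sum_(i <- s) p i)^-1 *: \sum_(i <- s) p i *: a i) /\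
    h ((\sum_(i <- s) p i)^-1 *: \sum_(i <- s) p i *: a i) <=
      (\sum_(i <- s) p i)^-1 * \sum_(i <- s) p i * h (a i).
  by have := main (index_enum I); rewrite p1 invr1 scale1r mul1r; apply.
elim: s => [|i s IH]; first by rewrite big_nil ltxx.
rewrite !big_cons.
have S0 : 0 <= \sum_(j <- s) p j by apply: sumr_ge0.
(* A tail of mass zero cannot be renormalized, but all its weights vanish. *)
have [S_eq0|S_neq0] := eqVneq (\sum_(j <- s) p j) 0.
  have z j : j \in s -> p j = 0.
    move=> js; apply/eqP; move/eqP: S_eq0; rewrite psumr_eq0 // => /allP /(_ j js).
    by rewrite implyTb.
  have -> : \sum_(j <- s) p j *: a j = 0.
    by rewrite big_seq big1 // => j js; rewrite z // scale0r.
  have -> : \sum_(j <- s) p j * h (a j) = 0.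
    by rewrite big_seq big1 // => j js; rewrite z // mul0r.
  rewrite S_eq0 !addr0 => pi0; rewrite scalerA mulVf ?gt_eqF // scale1r mulrA mulVf ?gt_eqF //.
  by rewrite mul1r.
have Sp : 0 < \sum_(j <- s) p j by rewrite lt_neqAle eq_sym S_neq0.
have [XS hS] := IH Sp.
move: XS hS; set S := \sum_(j <- s) p j in Sp *; set v := \sum_(j <- s) _ *: _.
set w := \sum_(j <- s) _ * _ => XS hS tot.
pose t := p i / (p i + S).
have t01 : 0 <= t <= 1.
  rewrite /t divr_ge0 ?(ltW tot) //= ler_pdivrMr // mul1r lerDl; exact: ltW.
have e1 : 1 - t = S / (p i + S) by rewrite /t; field; rewrite gt_eqF.
have [Xc hc] := conv _ _ t (Xa i) XS t01.
have e : (p i + S)^-1 *: (p i *: a i + v) = t *: a i + (1 - t) *: (S^-1 *: v).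
  rewrite scalerDr !scalerA e1 /t mulrC; congr (_ *: _ + _ *: _).
  by field; rewrite !gt_eqF.
rewrite e; split => //; apply: le_trans hc _.
have t1 : 0 <= 1 - t by rewrite e1 divr_ge0 ?(ltW tot) // ltW.
apply: (@le_trans _ _ (t * h (a i) + (1 - t) * (S^-1 * w))).
  by rewrite lerD2l ler_wpM2l.
rewrite le_eqVlt; apply/orP; left; apply/eqP; rewrite e1 /t; field.
by rewrite !gt_eqF.
Qed.

(** * Measurability of the mirror step *)

Section MeasurableMirror.
Context {R : realType} {d : measure_display} {T : measurableType d} {m : nat}.
Variables (N psi : 'rV[R]_m -> R) (X : set 'rV[R]_m).
Hypotheses (HN : is_norm N) (X0 : X !=set0) (cX : compact X) (convX : convex_set X).
Hypothesis dpsi : forall p, X p -> differentiable psi p.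
Hypothesis scpsi : strongly_convex1 N X psi.

Lemma measurable_bregman (v : T -> 'rV[R]_m) p : X p -> (forall o, X (v o)) ->
  measurable_vec v -> measurable_fun setT (fun o => bregman psi p (v o)).
Proof.
move=> Xp Xv mv.
have cpsi : {in X, continuous psi}.
  by move=> y /set_mem Xy; exact: (differentiable_continuous (dpsi Xy)).
have mpsi (z : T -> 'rV[R]_m) : (forall o, X (z o)) -> measurable_vec z ->
    measurable_fun setT (fun o => psi (z o)).
  by move=> Xz mz; exact: (measurable_continuous_comp Xz mz cpsi).
under eq_fun do rewrite bregmanE.
apply: measurable_funB; first by apply: measurable_funB => //; exact: mpsi.
apply: (@measurable_fun_cvg _ _ _ setT
  (fun k o => k.+1%:R * (psi (v o + k.+1%:R^-1 *: (p - v o)) - psi (v o)))) => [k|o _].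
  apply: measurable_funM => //; apply: measurable_funB; last exact: mpsi.
  apply: mpsi => [w|j]; first exact: convex_segment.
  under eq_fun do rewrite !mxE.
  apply: measurable_funD; first exact: mv.
  by apply: measurable_funM => //; apply: measurable_funB => //; exact: mv.
exact: (diff_quotient_cvg (dpsi (Xv o))).
Qed.

Lemma measurable_mirror_map (v y : T -> 'rV[R]_m) : (forall o, X (v o)) ->
  measurable_vec v -> measurable_vec y ->
  measurable_vec (fun o => mirror_map X psi (v o) (y o)).
Proof.
move=> Xv mv my; have [C C0 NC] := sup_norm_le_gauge HN.
(* The constant combines the sup-norm bound [C * N] with the factor 2 of the quadratic growth. *)
apply: (@measurable_argmin _ _ _ _ X
  (fun p o => dot (y o) (v o - p) + bregman psi p (v o)) _ (2 * C ^+ 2)).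
- by rewrite mulr_gt0 ?exprn_gt0.
- by move=> o; have [] := mirror_map_argmin X0 cX dpsi (y o) (Xv o).
- move=> p Xp; apply: measurable_funD; last exact: measurable_bregman.
  apply: measurable_dot => // k; under eq_fun do rewrite !mxE.
  by apply: measurable_funB => //; exact: mv.
- move=> p o Xp.
  have := mirror_objective_gap X0 cX convX dpsi scpsi (y o) (Xv o) Xp.
  move=> /=; set z := mirror_map _ _ _ _; set gap := dot _ _ + _ - _ => hgap.
  apply: (@le_trans _ _ ((C * N (p - z)) ^+ 2)).
    by rewrite lerXn2r ?nnegrE ?NC // mulr_ge0 ?(ltW C0) // (gauge_ge0 HN).
  rewrite exprMn (_ : 2 * C ^+ 2 * gap = C ^+ 2 * (2 * gap)); last by ring.
  rewrite ler_wpM2l ?sqr_ge0 //.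
  by move: hgap; rewrite ler_pdivrMr // mulrC.
- by move=> o; exact: (mirror_objective_continuous dpsi (Xv o)).
Qed.
End MeasurableMirror.

(** * Regret of the algorithm *)

Section Regret.
(* As in the theorem, [X], [N], [x] and the like take the network explicitly. *)
Unset Implicit Arguments.
Context {R : realType} {d : measure_display} {T : measurableType d} (P : probability T R).
Variables (n m : bool -> nat) (Hn : forall l, (0 < n l)%N).
Variables (X : forall l, set 'rV[R]_(m l)).
Hypotheses (HX0 : forall l, X l !=set0) (HXcompact : forall l, compact (X l)).
Hypothesis (HXconvex : forall l, convex_set (X l)).
Variables (N : forall l, 'rV[R]_(m l) -> R) (HN : forall l, is_norm (N l)).
Variable (f : forall l, 'I_(n l) -> profile R m -> R).
Variables (dxi : nat).
Variables (E : forall l, nat -> rel 'I_(n l)) (HEself : forall l t i, E l t i i).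
Variables (B : bool -> nat) (HB : forall l, (1 <= B l)%N).
Hypothesis HEconn : forall l, jointly_strongly_connected (E l) (B l).
Variables (eta0 : R) (Heta0 : 0 < eta0 < 1).
Variable w : forall l, nat -> 'I_(n l) -> 'I_(n l) -> R.
Hypotheses (Hw0 : forall l t i j, 0 <= w l t i j).
Hypotheses (HwE : forall l t i j, E l t j i -> eta0 <= w l t i j).
Hypotheses (HwnE : forall l t i j, ~~ E l t j i -> w l t i j = 0).
Hypotheses (Hwrow : forall l t i, \sum_j w l t i j = 1).
Hypotheses (Hwcol : forall l t j, \sum_i w l t i j = 1).
Variable w12 : forall l, nat -> 'I_(n l) -> 'I_(n (~~ l)) -> R.
Hypotheses (Hw12ge0 : forall l t i j, 0 <= w12 l t i j).
Hypotheses (Hw12row : forall l t i, \sum_j w12 l t i j = 1).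
Variable psi : forall l, 'rV[R]_(m l) -> R.
Hypotheses (Hpsidiff : forall l p, X l p -> differentiable (psi l) p).
Hypotheses (Hpsiconvex : forall l, strongly_convex1 (N l) (X l) (psi l)).
Variables (alpha : nat -> R) (Halpha0 : forall t, 0 <= alpha t).
Hypothesis Halpha : forall s t, (s <= t)%N -> alpha t <= alpha s.
Variables (x0 : forall l, 'I_(n l) -> 'rV[R]_(m l)) (Hx0 : forall l i, X l (x0 l i)).
Variable x : forall l, 'I_(n l) -> nat -> T -> 'rV[R]_(m l).
Variable xis : forall l, 'I_(n l) -> nat -> {RV P >-> dxi.-tuple R}.
Variable ghat : forall l, 'I_(n l) -> nat -> T -> 'rV[R]_(m l).
Hypothesis Hxinit : forall l i o, x l i 0%N o = x0 l i.
Hypothesis Xv : forall l i t o, X l (v_of w x i t o).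
Hypothesis Hghatmeas : forall l i t k,
  sub_measurable (history x xis t.+1) (fun o => ghat l i t o ord0 k).
Hypothesis Hxstep : forall l i t o, x l i t.+1 o =
  mirror_map (X l) (psi l) (v_of w x i t o) (- (alpha t *: ghat l i t o)).
Variables (L : R) (HL : 0 < L).
Hypothesis HA1 : forall l i y1 y2 y1' y2',
  X net1 y1 -> X net1 y1' -> X net2 y2 -> X net2 y2' ->
  `|f l i (y1, y2) - f l i (y1', y2')| <= L * (N net1 (y1 - y1') + N net2 (y2 - y2')).
Variables (nu : bool -> R) (Hnu : forall l, 0 < nu l).
Variable g : forall l, 'I_(n l) -> nat -> T -> 'rV[R]_(m l).
Hypothesis Hg : forall l i t o,
  partial_subdifferential X (f l i) (v_of w x i t o) (u_of w12 x i t o) (g l i t o).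
Hypothesis HA2mean : forall l i t k, is_cond_expectation P (history x xis t)
  (fun o => ghat l i t o ord0 k) (fun o => g l i t o ord0 k).
Hypothesis HA2var : forall l i t, exists2 Z : T -> R,
  is_cond_expectation P (history x xis t)
    (fun o => dual_norm (N l) (g l i t o - ghat l i t o) ^+ 2) Z &
  {ae P, forall o, Z o <= nu l ^+ 2}.
Hypothesis HgL : forall l i t o, dual_norm (N l) (g l i t o) <= L.
Hypothesis HA3convex : forall l y, X l y ->
  convex_function (X l) (fun p => bregman (psi l) y p).

Set Implicit Arguments.

Local Notation v := (v_of w x).
Local Notation u := (u_of w12 x).

Lemma iterate_in l i t o : X l (x l i t o).
Proof.
case: t => [|t]; first by rewrite Hxinit.
rewrite Hxstep.
by have [] := mirror_map_argmin (HX0 l) (HXcompact l) (Hpsidiff l)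
  (- (alpha t *: ghat l i t o)) (Xv l i t o).
Qed.

Lemma opponent_estimate_in l (i : 'I_(n l)) t o : X (~~ l) (u i t o).
Proof.
have [] := @jensen _ _ (X (~~ l)) (fun=> 0) _ (w12 l t i) (fun j => x (~~ l) j t o) => //.
  move=> y z a Xy Xz a01; split; first exact: convex_setP.
  by rewrite !mulr0 addr0.
by move=> j; exact: iterate_in.
Qed.

(** The generators of the history, repeated so that [hist] turns it into a measurable type on which
    the measurability lemmas apply. *)
Let gen t : set (set T) := [set A | exists l (i : 'I_(n l)),
  (exists k, preimage_set_system setT (fun o => x l i 0%N o ord0 k) measurable A) \/
  (exists2 s, (s < t)%N & preimage_set_system setT (xis l i s) measurable A)].

Let hist t := g_sigma_algebraType (gen t).

Lemma sub_measurableP t (h : T -> R) :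
  sub_measurable (history x xis t) h <-> measurable_fun setT (h : hist t -> R).
Proof.
split => [mh _ A mA|mh A mA]; first by rewrite setTI; exact: mh.
by have := mh measurableT A mA; rewrite setTI.
Qed.

Lemma history_mono t : history x xis t `<=` history x xis t.+1.
Proof.
apply: sub_sigma_algebra2 => A [l [i h]]; exists l, i; case: h => [h|[s st h]]; [left|right] => //.
by exists s => //; exact: ltnW.
Qed.

Lemma history_measurable t : history x xis t `<=` measurable.
Proof.
apply: smallest_sub; first exact: sigma_algebra_measurable.
move=> A [l [i [[k [C mC <-]]|[s st [C mC <-]]]]].
  have -> : (fun o => x l i 0%N o ord0 k) = cst (x0 l i ord0 k).
    by apply/funext => o; rewrite Hxinit.
  exact: measurable_cst.
exact: (measurable_funPT (xis l i s)).
Qed.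

(** The filtration advances with the algorithm: [v i t] is known at time [t], [ghat l i t] at time
    [t.+1]. *)
Lemma measurable_iterate t l i : measurable_vec (x l i t : hist t -> _).
Proof.
elim: t l i => [|t IH] l i.
  have -> : x l i 0%N = fun=> x0 l i by apply/funext => o; rewrite Hxinit.
  exact: measurable_vec_cst.
have -> : x l i t.+1 = fun o => mirror_map (X l) (psi l) (v i t o) (- (alpha t *: ghat l i t o)).
  by apply/funext => o; rewrite Hxstep.
apply: (measurable_mirror_map (HN l) (HX0 l) (HXcompact l) (HXconvex l) (Hpsidiff l) (Hpsiconvex l)).
- by move=> o; exact: Xv.
- apply: measurable_vec_sum => j k; apply/sub_measurableP => A mA; apply: history_mono.
  by have /sub_measurableP := IH l j k; exact.
- move=> k; under eq_fun do rewrite !mxE.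
  apply: measurable_funN; apply: measurable_funM => //.
  exact/sub_measurableP.
Qed.

Lemma measurable_v t l (i : 'I_(n l)) : measurable_vec (v i t : hist t -> _).
Proof. by apply: measurable_vec_sum => j; exact: measurable_iterate. Qed.

Lemma measurable_u t l (i : 'I_(n l)) : measurable_vec (u i t : hist t -> _).
Proof. by apply: measurable_vec_sum => j; exact: measurable_iterate. Qed.

Lemma measurable_vec_history t l (z : T -> 'rV[R]_l) :
  measurable_vec (z : hist t -> _) -> measurable_vec z.
Proof.
move=> mz k _ A mA; rewrite setTI; apply: history_measurable.
by have /sub_measurableP := mz k; exact.
Qed.

Lemma strategy_bound l : exists M, forall y, X l y -> `|y| <= M.
Proof.
have [M [_ hM]] := compact_bounded (HXcompact l).
by exists (M + 1) => y Xy; apply: (hM (M + 1)) => //; rewrite ltrDl.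
Qed.

Lemma noise_mean l i t y : X l y ->
  mean_le P (fun o => dot (g l i t o - ghat l i t o) (v i t o - y)) 0.
Proof.
move=> Xy; have [M hM] := strategy_bound l.
have orth k := @cond_expectation_orthogonal _ _ _ P (history x xis t)
  (fun o => ghat l i t o ord0 k) (fun o => g l i t o ord0 k)
  (fun o => (v i t o - y) ord0 k) (M + M) (@history_measurable t) (HA2mean l i t k).
have {}orth k :
    integrable_fun P (fun o => (v i t o - y) ord0 k * (g l i t o ord0 k - ghat l i t o ord0 k)) /\
    \int[P]_o ((v i t o - y) ord0 k * (g l i t o ord0 k - ghat l i t o ord0 k)) = 0.
  apply: orth.
    apply/sub_measurableP; under eq_fun do rewrite !mxE.
    by apply: measurable_funB => //; exact: measurable_v.
  move=> o; apply: le_trans (sup_norm_ge_coord _ _) _; apply: le_trans (ler_normB _ _) _.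
  by apply: lerD; apply: hM => //; exact: Xv.
have -> : (fun o => dot (g l i t o - ghat l i t o) (v i t o - y)) =
  (fun o => \sum_k (v i t o - y) ord0 k * (g l i t o ord0 k - ghat l i t o ord0 k)).
  by apply/funext => o; apply: eq_bigr => k _; rewrite mulrC !mxE.
apply: (@mean_leW _ _ _ _ _ (\sum_(k < m l) 0)); first by rewrite big1.
by apply: mean_le_sum => k; have [h1 h2] := orth k; split; rewrite ?h2.
Qed.

(** * Moments of the gradient noise and length of a mirror step *)

Definition sq_dev l (i : 'I_(n l)) t o : R := dual_norm (N l) (g l i t o - ghat l i t o) ^+ 2.

Lemma sq_dev_mean l i t : mean_le P (@sq_dev l i t) (nu l ^+ 2).
Proof.
have [Z [iQ iZ mZ condZ] Zle] := HA2var l i t.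
split; first exact: iQ.
have histT : history x xis t setT.
  by have := @measurableT _ (hist t).
rewrite -(condZ _ histT).
(* The bound on [Z] holds almost everywhere only; the truncation has the same integral and satisfies
   it everywhere. *)
pose Z' o := Num.min (Z o) (nu l ^+ 2).
have mZT : measurable_fun setT Z by apply/measurable_EFinP; exact: measurable_int iZ.
have mZ' : measurable_fun setT Z' by apply: measurable_minr => //.
have eZ : (\int[P]_o (Z o)%:E = \int[P]_o (Z' o)%:E)%E.
  apply: ae_eq_integral => //; try exact/measurable_EFinP.
  by apply: filterS Zle => o Zo _; rewrite /Z' min_l.
have iZ' : integrable_fun P Z'.
  have iS : integrable_fun P (fun o => `|Z o| + nu l ^+ 2).
    by apply: intgD; [exact: integrable_norm|exact: intg_cst].
  apply: (le_integrable measurableT _ _ iS); first exact/measurable_EFinP.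
  move=> o _ /=; rewrite lee_fin [leRHS]ger0_norm ?addr_ge0 ?sqr_ge0 //.
  rewrite /Z' minEle; case: ifP => _; first by rewrite lerDl sqr_ge0.
  by rewrite ger0_norm ?sqr_ge0 // lerDr.
rewrite /Rintegral eZ -[leRHS](Rint_cst P); apply: le_Rintegral => //; first exact: intg_cst.
by move=> o _; rewrite /Z' ge_min lexx orbT.
Qed.

(* Upper bound [L + E|g - ghat|] for the dual norm of [ghat], with
   [|g - ghat| <= (|g - ghat|^2 + nu^2) / (2 nu)] to avoid square roots. *)
Definition grad_bound l (i : 'I_(n l)) t o : R := L + (sq_dev i t o + nu l ^+ 2) / (2 * nu l).

(** Dominates the square of L + |g - ghat|. Squaring [grad_bound] instead would require a fourth
    moment of the noise. *)
Definition sq_grad_bound l (i : 'I_(n l)) t o : R :=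
  L ^+ 2 + 2 * L * ((sq_dev i t o + nu l ^+ 2) / (2 * nu l)) + sq_dev i t o.

(** The weight [nu l] in the AM-GM bound recovers the value given by Cauchy-Schwarz, since (nu^2 +
    nu^2) / (2 nu) = nu. *)
Lemma dev_mean l i t :
  mean_le P (fun o => (@sq_dev l i t o + nu l ^+ 2) / (2 * nu l)) (nu l).
Proof.
have nu0 := Hnu l.
have h := mean_leZ (a := (2 * nu l)^-1) _
  (mean_leD (@sq_dev_mean l i t) (mean_le_cst P (nu l ^+ 2))).
have {h} := h (_ : 0 <= _); rewrite invr_ge0 mulr_ge0 ?ler0n ?(ltW nu0) // => /(_ isT).
have -> : (2 * nu l)^-1 * (nu l ^+ 2 + nu l ^+ 2) = nu l.
  by field; rewrite gt_eqF.
by under eq_fun do rewrite mulrC.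
Qed.

Lemma grad_bound_mean l i t : mean_le P (@grad_bound l i t) (L + nu l).
Proof. by apply: mean_leD; [exact: mean_le_cst|exact: dev_mean]. Qed.

Lemma sq_grad_bound_mean l i t : mean_le P (@sq_grad_bound l i t) ((L + nu l) ^+ 2).
Proof.
have -> : (L + nu l) ^+ 2 = L ^+ 2 + 2 * L * nu l + nu l ^+ 2 by ring.
apply: mean_leD; last exact: sq_dev_mean.
apply: mean_leD; first exact: mean_le_cst.
by apply: mean_leZ; [rewrite mulr_ge0 ?ler0n ?(ltW HL)|exact: dev_mean].
Qed.

Lemma grad_bound_ge0 l (i : 'I_(n l)) t o : 0 <= grad_bound i t o.
Proof.
rewrite addr_ge0 ?(ltW HL) // divr_ge0 ?addr_ge0 ?sqr_ge0 // mulr_ge0 ?ler0n //.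
exact: ltW.
Qed.

Local Notation dev i t o := (dual_norm (N _) (g _ i t o - ghat _ i t o)).

Lemma dev_le l (i : 'I_(n l)) t o : dev i t o <= (sq_dev i t o + nu l ^+ 2) / (2 * nu l).
Proof.
have nu0 := Hnu l; rewrite ler_pdivlMr ?mulr_gt0 //.
by have := sqr_ge0 (dev i t o - nu l); rewrite sqrrB /sq_dev; lra.
Qed.

Lemma dot_ghat_le l (i : 'I_(n l)) t o z :
  dot (ghat l i t o) z <= (L + dev i t o) * N l z.
Proof.
have -> : dot (ghat l i t o) z = dot (g l i t o) z + dot (g l i t o - ghat l i t o) (- z).
  by rewrite dotBl !dotN; lra.
rewrite mulrDl; apply: lerD.
  apply: le_trans (dot_le_dual_norm (HN l) _ _) _.
  by rewrite ler_wpM2r ?(gauge_ge0 (HN l)).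
by rewrite -(gaugeN (HN l) z); exact: dot_le_dual_norm.
Qed.

(** The three-point inequality is taken at the starting point [v] itself: the two divergences
    between [v] and the new iterate add up to at least the squared length, and one factor
    cancels. *)
Lemma step_le l (i : 'I_(n l)) t o :
  N l (x l i t.+1 o - v i t o) <= alpha t * grad_bound i t o.
Proof.
rewrite Hxstep; set xp := mirror_map _ _ _ _.
have Xp : X l xp by rewrite /xp -Hxstep; exact: iterate_in.
have tp := mirror_three_point (HX0 l) (HXcompact l) (HXconvex l) (Hpsidiff l)
  (- (alpha t *: ghat l i t o)) (Xv l i t o) (Xv l i t o).
have b1 := bregman_ge (Hpsidiff l) (Hpsiconvex l) (Xv l i t o) Xp.
have b2 := bregman_ge (Hpsidiff l) (Hpsiconvex l) Xp (Xv l i t o).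
have dl := dot_ghat_le i t o (v i t o - xp).
move: tp; rewrite /= -/xp dotNl dotZl bregmanxx => tp.
rewrite (gauge_distC (HN l)) in b1; rewrite (gauge_distC (HN l) (v i t o)) in dl.
have N0 := gauge_ge0 (HN l) (xp - v i t o).
have := dev_le i t o; rewrite /grad_bound => dle.
set Nz := N l _ in b1 b2 dl N0 *; set e := (_ + _) / _ in dle *.
have e0 : 0 <= L + e by exact: (grad_bound_ge0 i t o).
have a0 := Halpha0 t.
have sq : Nz * Nz <= (alpha t * (L + e)) * Nz.
  rewrite -expr2; apply: (@le_trans _ _ (alpha t * dot (ghat l i t o) (v i t o - xp))); first lra.
  rewrite -mulrA ler_wpM2l //; apply: le_trans dl _; rewrite ler_wpM2r //; lra.
have [Nz0|Nz0] := eqVneq Nz 0; first by rewrite Nz0 mulr_ge0.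
by rewrite ler_pM2r // lt_neqAle eq_sym Nz0 in sq.
Qed.

(** Split v - y = (v - xp) - (y - xp). The second part is the three-point inequality; Young's
    inequality on the first leaves half the squared step, absorbed by the divergence of [xp] from
    [v]. *)
Lemma gradient_step l (i : 'I_(n l)) t o y : X l y ->
  alpha t * dot (ghat l i t o) (v i t o - y) <=
  bregman (psi l) y (v i t o) - bregman (psi l) y (x l i t.+1 o) +
  alpha t ^+ 2 * sq_grad_bound i t o / 2.
Proof.
move=> Xy; rewrite Hxstep; set xp := mirror_map _ _ _ _.
have Xp : X l xp by rewrite /xp -Hxstep; exact: iterate_in.
have tp := mirror_three_point (HX0 l) (HXcompact l) (HXconvex l) (Hpsidiff l)
  (- (alpha t *: ghat l i t o)) (Xv l i t o) Xy.
have b2 := bregman_ge (Hpsidiff l) (Hpsiconvex l) Xp (Xv l i t o).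
have dl := dot_ghat_le i t o (v i t o - xp).
move: tp; rewrite /= -/xp dotNl dotZl => tp.
rewrite (gauge_distC (HN l) (v i t o)) in dl.
have dle := dev_le i t o.
have a0 := Halpha0 t.
have -> : v i t o - y = (v i t o - xp) - (y - xp) by rewrite opprB addrA subrK.
rewrite dotB mulrBr.
have : alpha t * dot (ghat l i t o) (v i t o - xp) <=
    N l (xp - v i t o) ^+ 2 / 2 + alpha t ^+ 2 * sq_grad_bound i t o / 2.
  apply: le_trans (ler_wpM2l a0 dl) _.
  have sqle : (L + dev i t o) ^+ 2 <= sq_grad_bound i t o.
    rewrite /sq_grad_bound; have := ler_wpM2l (ltW HL) dle; rewrite sqrrD /sq_dev.
    by move: (_ / _) => e; lra.
  have := ler_wpM2l (sqr_ge0 (alpha t)) sqle; rewrite -exprMn.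
  have := sqr_ge0 (alpha t * (L + dev i t o) - N l (xp - v i t o)).
  rewrite sqrrB; set a := alpha t * (L + _); set c := alpha t ^+ 2 * _ => h1 h2.
  rewrite mulrA -/a; lra.
by lra.
Qed.

(** * Consensus error along the algorithm *)

Local Notation Gamma l := (Gam eta0 (n l)).
Local Notation th l := (theta eta0 (n l) (B l)).

Definition mean_state l t o := average (fun t (i : 'I_(n l)) => x l i t o) t.

(** The mirror displacement [x s.+1 - v s] is the perturbation of the averaging, here replaced by
    its pathwise bound. The deviation bounded is that of time [t.+1]. *)
Definition consensus_bound l (i : 'I_(n l)) t o : R :=
  Gamma l * th l ^+ t * \sum_j N l (x0 l j) +
  Gamma l * \sum_(s < t) th l ^+ (t - s.+1) * \sum_(j < n l) alpha s * grad_bound j s o +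
  (alpha t * grad_bound i t o + (n l)%:R^-1 * \sum_(j < n l) alpha t * grad_bound j t o).

Lemma Gam_ge0 l : 0 <= Gamma l.
Proof. by rewrite /Gam invr_ge0 sqr_ge0. Qed.

Lemma theta_ge0 l : 0 <= th l.
Proof. exact: powR_ge0. Qed.

Lemma consensus_le l (i : 'I_(n l)) t o :
  N l (x l i t.+1 o - mean_state l t.+1 o) <= consensus_bound i t o.
Proof.
have xS s (j : 'I_(n l)) : x l j s.+1 o = \sum_k w l s j k *: x l k s o + (x l j s.+1 o - v j s o).
  by rewrite addrC subrK.
have := consensus_error (HN l) (Hn l) Heta0 (Hw0 l) (HEself l) (HwE l) (HwnE l)
  (Hwrow l) (Hwcol l) (HB l) (HEconn l) (x := fun s j => x l j s o)
  (p := fun s j => x l j s.+1 o - v j s o) xS t i.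
move=> /le_trans; apply; apply: lerD; first apply: lerD.
- rewrite ler_wpM2l ?mulr_ge0 ?Gam_ge0 ?exprn_ge0 ?theta_ge0 //.
  by apply: ler_sum => j _; rewrite Hxinit.
- rewrite ler_wpM2l ?Gam_ge0 //; apply: ler_sum => s _.
  rewrite ler_wpM2l ?exprn_ge0 ?theta_ge0 //; apply: ler_sum => j _; exact: step_le.
- apply: lerD; first exact: step_le.
  rewrite ler_wpM2l ?invr_ge0 ?ler0n //; apply: ler_sum => j _; exact: step_le.
Qed.

Definition consensus_rate l t : R :=
  Gamma l * th l ^+ t * ((n l)%:R * \big[Num.max/0]_(j < n l) N l (x0 l j)) +
  Gamma l * \sum_(s < t) th l ^+ (t - s.+1) * ((n l)%:R * (alpha s * (L + nu l))) +
  (alpha t * (L + nu l) + alpha t * (L + nu l)).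

Lemma consensus_mean l (i : 'I_(n l)) t : mean_le P (consensus_bound i t) (consensus_rate l t).
Proof.
have nR0 : (n l)%:R != 0 :> R by rewrite pnatr_eq0 -lt0n.
have sumb s : mean_le P (fun o => \sum_(j < n l) alpha s * grad_bound j s o)
    ((n l)%:R * (alpha s * (L + nu l))).
  have -> : (n l)%:R * (alpha s * (L + nu l)) = \sum_(j < n l) alpha s * (L + nu l).
    by rewrite sumr_const card_ord mulr_natl.
  by apply: mean_le_sum => j; apply: mean_leZ => //; exact: grad_bound_mean.
apply: mean_leD; first apply: mean_leD.
- apply: mean_leW (mean_le_cst P _).
  rewrite ler_wpM2l ?mulr_ge0 ?Gam_ge0 ?exprn_ge0 ?theta_ge0 //.
  apply: (@le_trans _ _ (\sum_(j < n l) \big[Num.max/0]_(k < n l) N l (x0 l k))).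
    by apply: ler_sum => j _; apply: (le_bigmax _ (fun k => N l (x0 l k)) j).
  by rewrite sumr_const card_ord mulr_natl.
- apply: mean_leZ; first exact: Gam_ge0.
  apply: mean_le_sum => s; apply: mean_leZ; first by rewrite exprn_ge0 ?theta_ge0.
  exact: sumb.
- apply: mean_leD; first by apply: mean_leZ => //; exact: grad_bound_mean.
  have -> : alpha t * (L + nu l) = (n l)%:R^-1 * ((n l)%:R * (alpha t * (L + nu l))).
    by rewrite mulKf.
  by apply: mean_leZ; [rewrite invr_ge0 ler0n|exact: sumb].
Qed.

Lemma v_consensus l (i : 'I_(n l)) t o :
  N l (v i t.+1 o - mean_state l t.+1 o) <= \sum_k w l t.+1 i k * consensus_bound k t o.
Proof.
apply: le_trans (gauge_convex_dist (HN l) _ _ (Hw0 l t.+1 i) (Hwrow l t.+1 i)) _.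
by apply: ler_sum => k _; rewrite ler_wpM2l //; exact: consensus_le.
Qed.

Lemma u_consensus l (i : 'I_(n l)) t o :
  N (~~ l) (u i t.+1 o - mean_state (~~ l) t.+1 o) <=
  \sum_k w12 l t.+1 i k * consensus_bound k t o.
Proof.
apply: le_trans (gauge_convex_dist (HN (~~ l)) _ _ (Hw12ge0 l t.+1 i) (Hw12row l t.+1 i)) _.
by apply: ler_sum => k _; rewrite ler_wpM2l //; exact: consensus_le.
Qed.

Lemma weighted_consensus_mean l t (p : 'I_(n l) -> R) :
  (forall k, 0 <= p k) -> \sum_k p k = 1 ->
  mean_le P (fun o => \sum_k p k * consensus_bound k t o) (consensus_rate l t).
Proof.
move=> p0 p1; rewrite -[consensus_rate l t]mul1r -p1 mulr_suml.
by apply: mean_le_sum => k; apply: mean_leZ => //; exact: consensus_mean.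
Qed.

(** The Lipschitz bound (A1) on the product of the strategy sets gives measurability through a dense
    sequence of pairs, enumerated by [idx], and boundedness through compactness. *)
Lemma cost_term_integrable l (j : 'I_(n l)) (z1 : T -> 'rV[R]_(m net1)) (z2 : T -> 'rV[R]_(m net2)) :
  (forall o, X net1 (z1 o)) -> (forall o, X net2 (z2 o)) ->
  measurable_vec z1 -> measurable_vec z2 ->
  integrable_fun P (fun o => f l j (z1 o, z2 o)).
Proof.
move=> Xz1 Xz2 mz1 mz2.
have [C1 C10 NC1] := gauge_le_sup_norm (HN net1).
have [C2 C20 NC2] := gauge_le_sup_norm (HN net2).
have [q1 [Xq1 dq1]] := dense_sequence (HX0 net1).
have [q2 [Xq2 dq2]] := dense_sequence (HX0 net2).
pose idx k : nat * nat := odflt (0, 0)%N (unpickle k).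
have C0 : 0 < L * (C1 + C2) by rewrite mulr_gt0 // addr_gt0.
have lip y1 y2 y1' y2' e : X net1 y1 -> X net1 y1' -> X net2 y2 -> X net2 y2' ->
    `|y1 - y1'| <= e -> `|y2 - y2'| <= e ->
    `|f l j (y1, y2) - f l j (y1', y2')| <= L * (C1 + C2) * e.
  move=> h1 h2 h3 h4 e1 e2; apply: le_trans (HA1 l j _ _ _ _ h1 h2 h3 h4) _.
  rewrite -mulrA ler_wpM2l ?(ltW HL) // mulrDl; apply: lerD.
    by apply: le_trans (NC1 _) _; rewrite ler_wpM2l // ltW.
  by apply: le_trans (NC2 _) _; rewrite ler_wpM2l // ltW.
have mf : measurable_fun setT (fun o => f l j (z1 o, z2 o)).
  apply: (@measurable_fun_dense _ _ _ _ (fun k => f l j (q1 (idx k).1, q2 (idx k).2))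
    (fun e k => [set o | `|z1 o - q1 (idx k).1| < e] `&` [set o | `|z2 o - q2 (idx k).2| < e])).
  - by move=> e k; apply: measurableI; apply: measurable_lt_set; exact: measurable_sup_dist.
  - by move=> e e' k ee' o [/= h1 h2]; split; [exact: lt_le_trans h1 ee'|exact: lt_le_trans h2 ee'].
  - move=> e o e0; have [k1 h1] := dq1 _ _ (Xz1 o) e0; have [k2 h2] := dq2 _ _ (Xz2 o) e0.
    by exists (pickle (k1, k2)); rewrite /idx pickleK.
  move=> e o e0; exists (e / (2 * (L * (C1 + C2)))); first by rewrite divr_gt0 // mulr_gt0.
  move=> k [/= h1 h2]; rewrite distrC.
  apply: le_lt_trans (lip _ _ _ _ _ _ _ _ _ (ltW h1) (ltW h2)) _ => //.
  move: (L * (C1 + C2)) C0 => D D0.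
  have -> : D * (e / (2 * D)) = e / 2 by field; rewrite gt_eqF.
  by lra.
have [M1 hM1] := strategy_bound net1; have [M2 hM2] := strategy_bound net2.
have Xq1' := Xq1 0%N; have Xq2' := Xq2 0%N.
have h1 o : `|z1 o - q1 0%N| <= M1 + M1.
  by apply: le_trans (ler_normB _ _) _; apply: lerD; exact: hM1.
have h2 o : `|z2 o - q2 0%N| <= M2 + M2.
  by apply: le_trans (ler_normB _ _) _; apply: lerD; exact: hM2.
apply: (@intg_bounded _ _ _ _ _ (`|f l j (q1 0%N, q2 0%N)| +
  L * (C1 + C2) * Num.max (M1 + M1) (M2 + M2))) => // o.
rewrite -[f l j (z1 o, _)](subrK (f l j (q1 0%N, q2 0%N))) addrC.
apply: le_trans (ler_normD _ _) _; rewrite lerD2l; apply: lip => //.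
  by apply: le_trans (h1 o) _; rewrite le_max lexx.
by apply: le_trans (h2 o) _; rewrite le_max lexx orbT.
Qed.


(** * Regret at a single time and its summation *)

Lemma own_estimate_diff t (i j : 'I_(n net1)) o :
  N net1 (x net1 i t.+1 o - v j t.+1 o) <=
  consensus_bound i t o + \sum_k w net1 t.+1 j k * consensus_bound k t o.
Proof.
apply: le_trans (gauge_triangle (HN net1) (mean_state net1 t.+1 o) _ _) _.
by rewrite (gauge_distC (HN net1) (mean_state _ _ _)); apply: lerD;
  [exact: consensus_le|exact: v_consensus].
Qed.

Lemma opponent_estimate_diff t (i j : 'I_(n net1)) o :
  N net2 (u i t.+1 o - u j t.+1 o) <=
  \sum_k w12 net1 t.+1 i k * consensus_bound (l := net2) k t o +
  \sum_k w12 net1 t.+1 j k * consensus_bound (l := net2) k t o.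
Proof.
apply: le_trans (gauge_triangle (HN net2) (mean_state net2 t.+1 o) _ _) _.
rewrite (gauge_distC (HN net2) (mean_state _ _ _)); apply: lerD; exact: (@u_consensus net1).
Qed.

(** The opponent deviation carries [2 * L] because [u i] is exchanged for [u j] twice, at the
    iterate and at [y]. The divergences are left out: they telescope only after summation over
    time. *)
Definition instant_bound t (i : 'I_(n net1)) (y : 'rV[R]_(m net1)) o : R :=
  (n net1)%:R^-1 * \sum_(j < n net1)
    (L * (consensus_bound i t o + \sum_k w net1 t.+1 j k * consensus_bound k t o) +
     2 * L * (\sum_k w12 net1 t.+1 i k * consensus_bound (l := net2) k t o +
              \sum_k w12 net1 t.+1 j k * consensus_bound (l := net2) k t o) +
     dot (g net1 j t.+1 o - ghat net1 j t.+1 o) (v j t.+1 o - y) +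
     alpha t.+1 / 2 * sq_grad_bound j t.+1 o).

Definition instant_rate t : R :=
  2 * L * consensus_rate net1 t + 4 * L * consensus_rate net2 t +
  alpha t.+1 / 2 * (L + nu net1) ^+ 2.

Lemma instant_bound_mean t i y : X net1 y -> mean_le P (instant_bound t i y) (instant_rate t).
Proof.
move=> Xy.
have nR0 : (n net1)%:R != 0 :> R by rewrite pnatr_eq0 -lt0n.
have -> : instant_rate t = (n net1)%:R^-1 * ((n net1)%:R * instant_rate t) by rewrite mulKf.
apply: mean_leZ; first by rewrite invr_ge0 ler0n.
have -> : (n net1)%:R * instant_rate t = \sum_(j < n net1) instant_rate t.
  by rewrite sumr_const card_ord mulr_natl.
apply: mean_le_sum => j.
have -> : instant_rate t = L * (consensus_rate net1 t + consensus_rate net1 t) +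
    2 * L * (consensus_rate net2 t + consensus_rate net2 t) + 0 +
    alpha t.+1 / 2 * (L + nu net1) ^+ 2 by rewrite /instant_rate; ring.
have L0 := ltW HL.
apply: mean_leD; first apply: mean_leD; first apply: mean_leD.
- apply: mean_leZ => //; apply: mean_leD; first exact: consensus_mean.
  exact: weighted_consensus_mean.
- apply: mean_leZ; first by rewrite mulr_ge0 ?ler0n.
  by apply: mean_leD; apply: (@weighted_consensus_mean net2); try exact: (Hw12ge0 net1);
    exact: (Hw12row net1).
- exact: noise_mean.
- by apply: mean_leZ; [rewrite divr_ge0 ?ler0n|exact: sq_grad_bound_mean].
Qed.

Lemma instant_regret t (i j : 'I_(n net1)) y o : X net1 y -> 0 < alpha t.+1 ->
  f net1 j (x net1 i t.+1 o, u i t.+1 o) - f net1 j (y, u i t.+1 o) <=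
  L * (consensus_bound i t o + \sum_k w net1 t.+1 j k * consensus_bound k t o) +
  2 * L * (\sum_k w12 net1 t.+1 i k * consensus_bound (l := net2) k t o +
           \sum_k w12 net1 t.+1 j k * consensus_bound (l := net2) k t o) +
  dot (g net1 j t.+1 o - ghat net1 j t.+1 o) (v j t.+1 o - y) +
  alpha t.+1 / 2 * sq_grad_bound j t.+1 o +
  (bregman (psi net1) y (v j t.+1 o) - bregman (psi net1) y (x net1 j t.+2 o)) / alpha t.+1.
Proof.
move=> Xy a0.
have Xui := @opponent_estimate_in net1 i t.+1 o.
have Xuj := @opponent_estimate_in net1 j t.+1 o.
have Xxi := @iterate_in net1 i t.+1 o.
have Xvj := Xv net1 j t.+1 o.
have := own_estimate_diff t i j o; have := opponent_estimate_diff t i j o.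
move=> hu hv.
have [_ /(_ y Xy) sub] := Hg net1 j t.+1 o.
rewrite /= in sub.
have h1 := HA1 net1 j _ _ _ _ Xxi Xvj Xui Xuj.
have h2 := HA1 net1 j _ _ _ _ Xy Xy Xuj Xui.
have gs := @gradient_step net1 j t.+1 o y Xy.
rewrite subrr (gauge0 (HN net1)) add0r (gauge_distC (HN net2)) in h2.
have L0 := ltW HL.
have hvL := ler_wpM2l L0 hv; have huL := ler_wpM2l L0 hu.
have gs' : dot (ghat net1 j t.+1 o) (v j t.+1 o - y) <=
    (bregman (psi net1) y (v j t.+1 o) - bregman (psi net1) y (x net1 j t.+2 o)) / alpha t.+1 +
    alpha t.+1 / 2 * sq_grad_bound j t.+1 o.
  rewrite -(ler_pM2l a0); apply: le_trans gs _.
  move: (bregman _ _ _ - bregman _ _ _) (sq_grad_bound _ _ _) => D S.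
  by rewrite le_eqVlt; apply/orP; left; apply/eqP; field; rewrite gt_eqF.
have sub' : f net1 j (v j t.+1 o, u j t.+1 o) - f net1 j (y, u j t.+1 o) <=
    dot (g net1 j t.+1 o) (v j t.+1 o - y).
  by rewrite -[v j t.+1 o - y]opprB dotN; lra.
rewrite dotBl.
have h1' := le_trans (ler_norm _) h1; have h2' := le_trans (ler_norm _) h2.
rewrite mulrDr in h1'.
lra.
Qed.

(** This closes the telescoping: [gradient_step] relates the divergences at [v t] and [x t.+1], and
    averaging over the agents returns from [v t] to [x t]. *)
Lemma average_bregman_le y t o : X net1 y ->
  (n net1)%:R^-1 * \sum_(j < n net1) bregman (psi net1) y (v j t o) <=
  (n net1)%:R^-1 * \sum_(j < n net1) bregman (psi net1) y (x net1 j t o).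
Proof.
move=> Xy; rewrite ler_wpM2l ?invr_ge0 ?ler0n //.
apply: (@le_trans _ _ (\sum_(j < n net1) \sum_k w net1 t j k * bregman (psi net1) y (x net1 k t o))).
  apply: ler_sum => j _.
  have [] // := @jensen _ _ (X net1) (bregman (psi net1) y) _ (w net1 t j) (fun k => x net1 k t o).
    by move=> z z' a Xz Xz' a01; split;
      [exact: convex_setP|exact: (convex_functionP (HA3convex net1 y Xy))].
  by move=> k; exact: iterate_in.
rewrite exchange_big /=; apply: ler_sum => k _.
by rewrite -mulr_suml Hwcol mul1r.
Qed.

Lemma iterate_cost_integrable t (i j : 'I_(n net1)) :
  integrable_fun P (fun o => f net1 j (x net1 i t o, u i t o)).
Proof.
apply: cost_term_integrable => [a|a||]; [exact: iterate_in|exact: (@opponent_estimate_in net1)| |].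
  by apply: (@measurable_vec_history t); exact: measurable_iterate.
by apply: (@measurable_vec_history t); exact: (@measurable_u t net1).
Qed.

Lemma fixed_cost_integrable t (i j : 'I_(n net1)) y : X net1 y ->
  integrable_fun P (fun o => f net1 j (y, u i t o)).
Proof.
move=> Xy; apply: cost_term_integrable => [//|a||]; [exact: (@opponent_estimate_in net1)| |].
  exact: measurable_vec_cst.
by apply: (@measurable_vec_history t); exact: (@measurable_u t net1).
Qed.

Lemma total_iterate_cost_integrable K (i : 'I_(n net1)) :
  integrable_fun P (fun o => \sum_(t < K) cost f (x net1 i t.+1 o, u i t.+1 o)).
Proof.
apply: intg_sum => t; apply: intgZ; apply: intg_sum => j; exact: iterate_cost_integrable.
Qed.

Lemma total_fixed_cost_integrable K (i : 'I_(n net1)) y : X net1 y ->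
  integrable_fun P (fun o => \sum_(t < K) cost f (y, u i t.+1 o)).
Proof.
move=> Xy; apply: intg_sum => t; apply: intgZ; apply: intg_sum => j.
exact: fixed_cost_integrable.
Qed.

Lemma regret_mean K (i : 'I_(n net1)) y D : 0 < alpha K.+1 -> X net1 y ->
  (forall z, X net1 z -> bregman (psi net1) y z <= D) ->
  mean_le P (fun o => \sum_(t < K.+1) cost f (x net1 i t.+1 o, u i t.+1 o) -
                      \sum_(t < K.+1) cost f (y, u i t.+1 o))
    (\sum_(t < K.+1) instant_rate t + D / alpha K.+1).
Proof.
move=> aK Xy HD.
have nR0 : 0 < (n net1)%:R :> R by rewrite ltr0n.
have apos t : (t <= K.+1)%N -> 0 < alpha t.
  by move=> tK; apply: lt_le_trans aK _; exact: Halpha.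
apply: (mean_le_le (Z := fun o => \sum_(t < K.+1) instant_bound t i y o + D / alpha K.+1)).
- by apply: intgB; [exact: total_iterate_cost_integrable|exact: total_fixed_cost_integrable].
- move=> o; rewrite -sumrB.
  pose A t := (n net1)%:R^-1 * \sum_(j < n net1) bregman (psi net1) y (x net1 j t.+1 o).
  (* Step sizes may vanish beyond the horizon, so they are frozen at their last value to be positive
     at all times. *)
  pose al t := alpha (minn t.+1 K.+1).
  have tele : \sum_(t < K.+1) (A t - A t.+1) / al t <= D / alpha K.+1.
    have -> : alpha K.+1 = al K by rewrite /al minnn.
    apply: weighted_telescope.
    + by move=> t; apply: apos; rewrite geq_minr.
    + by move=> t; apply: Halpha; rewrite leq_min geq_minr andbT (leq_trans (geq_minl _ _)).
    + move=> t; apply/andP; split.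
        rewrite mulr_ge0 ?invr_ge0 ?ler0n // sumr_ge0 // => j _.
        by apply: (bregman_ge0 (Hpsidiff net1) (Hpsiconvex net1)) => //; exact: iterate_in.
      rewrite ler_pdivrMl // mulr_natl -[X in D *+ X](card_ord (n net1)) -sumr_const.
      by apply: ler_sum => j _; apply: HD; exact: iterate_in.
  apply: le_trans (lerD (lexx _) tele); rewrite -big_split /=; apply: ler_sum => t _.
  have at0 : 0 < alpha t.+1 by exact: apos.
  have -> : al t = alpha t.+1 by rewrite /al (minn_idPl _) // ltn_ord.
  rewrite /cost -mulrBr -sumrB.
  apply: (@le_trans _ _ (instant_bound t i y o +
      ((n net1)%:R^-1 * \sum_(j < n net1) bregman (psi net1) y (v j t.+1 o) - A t.+1) / alpha t.+1)).
    rewrite /instant_bound /A -mulrBr -mulrA -mulrDr ler_wpM2l ?invr_ge0 ?ler0n //.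
    rewrite -sumrB mulr_suml -big_split /=; apply: ler_sum => j _.
    exact: instant_regret.
  rewrite lerD2l ler_wpM2r ?invr_ge0 ?(ltW at0) // lerD2r.
  exact: average_bregman_le.
- apply: mean_leD; last exact: mean_le_cst.
  by apply: mean_le_sum => t; exact: instant_bound_mean.
Qed.

(** Origin of [9 * L + nu]: in the coefficient of [alpha t], the first network needs 4L(L + nu) + (L
    + nu)^2 / 2, exactly half of (L + nu)(9L + nu), and the second 8L(L + nu), short of it by (L +
    nu)^2. *)
Lemma instant_rate_le t : instant_rate t <=
  \sum_(l : bool) (L + nu l) * (9 * L + nu l) * alpha t +
  4 * L * \sum_(l : bool) (n l)%:R * Gamma l * (L + nu l) *
     \sum_(s < t) th l ^+ (t - s.+1) * alpha s +
  4 * L * \sum_(l : bool) (n l)%:R * Gamma l * th l ^+ t *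
     \big[Num.max/0]_(j < n l) N l (x0 l j).
Proof.
pose S l := (n l)%:R * Gamma l * (L + nu l) * \sum_(s < t) th l ^+ (t - s.+1) * alpha s.
pose I l := (n l)%:R * Gamma l * th l ^+ t * \big[Num.max/0]_(j < n l) N l (x0 l j).
have Ln l : 0 < L + nu l by rewrite addr_gt0.
have S0 l : 0 <= S l.
  rewrite mulr_ge0 ?(ltW (Ln l)) // ?mulr_ge0 ?ler0n ?Gam_ge0 ?(ltW (Ln l)) //.
  by apply: sumr_ge0 => s _; rewrite mulr_ge0 ?exprn_ge0 ?theta_ge0.
have I0 l : 0 <= I l.
  rewrite mulr_ge0 ?mulr_ge0 ?ler0n ?Gam_ge0 ?exprn_ge0 ?theta_ge0 //.
  exact: bigmax_ge_id.
have rateE l : consensus_rate l t = I l + S l + 2 * (L + nu l) * alpha t.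
  have -> : S l = Gamma l * \sum_(s < t) th l ^+ (t - s.+1) * ((n l)%:R * (alpha s * (L + nu l))).
    by rewrite /S !mulr_sumr; apply: eq_bigr => s _; ring.
  by rewrite /consensus_rate /I; ring.
rewrite !big_bool /= -/(S net1) -/(S net2) -/(I net1) -/(I net2) /instant_rate !rateE.
have a0 := Halpha0 t; have a1 : alpha t.+1 <= alpha t by exact: Halpha.
have p1 : alpha t.+1 * (L + nu net1) ^+ 2 <= alpha t * (L + nu net1) ^+ 2.
  by rewrite ler_wpM2r ?sqr_ge0.
have n1 := Hnu net1; have n2 := Hnu net2.
have LS1 := mulr_ge0 (ltW HL) (S0 net1); have LI1 := mulr_ge0 (ltW HL) (I0 net1).
have q1 : 0 <= alpha t * (L + nu net1) * (9 / 2 * L + nu net1 / 2).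
  by apply: mulr_ge0; [rewrite mulr_ge0 // ltW // Ln|
    rewrite addr_ge0 ?mulr_ge0 ?divr_ge0 ?ler0n ?(ltW HL) ?(ltW n1)].
have q2 : 0 <= alpha t * (L + nu net2) * (L + nu net2).
  by rewrite !mulr_ge0 ?(ltW (Ln _)).
move: (S net1) (S net2) (I net1) (I net2) LS1 LI1 => S1 S2 I1 I2 LS1 LI1.
lra.
Qed.
End Regret.

(** * The regret bound in the extended reals *)

Theorem theorem2 (R : realType)
  (* probability space *)
  (d : measure_display) (T : measurableType d) (P : probability T R)
  (* game *)
  (n m : bool -> nat) (Hn : forall l, (0 < n l)%N)
  (X : forall l, set 'rV[R]_(m l))
  (HX0 : forall l, X l !=set0)
  (HXcompact : forall l, compact (X l))
  (HXconvex : forall l, convex_set (X l))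
  (N : forall l, 'rV[R]_(m l) -> R) (HN : forall l, is_norm (N l))
  (f : forall l, 'I_(n l) -> profile R m -> R)
  (Hfcont : forall l i, {within X net1 `*` X net2, continuous (f l i)})
  (Hfconvex : forall l i (opp : 'rV[R]_(m (~~ l))), X (~~ l) opp ->
     convex_function (X l) (fun own => f l i (play own opp)))
  (Hfconcave : forall l i (own : 'rV[R]_(m l)), X l own ->
     convex_function (X (~~ l)) (fun opp => - f l i (play own opp)))
  (Hzerosum : forall z, (X net1 `*` X net2) z ->
     cost f z = - ((n net2)%:R^-1 * \sum_(j < n net2) f net2 j z))
  (dxi : nat) (xi : {RV P >-> dxi.-tuple R})
  (F : forall l, 'I_(n l) -> profile R m -> dxi.-tuple R -> R)
  (HF : forall l i z, (X net1 `*` X net2) z ->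
     P.-integrable setT (EFin \o (fun o => F l i z (xi o))) /\
     ((f l i z)%:E = 'E_P[fun o => F l i z (xi o)])%E)
  (* communication *)
  (E : forall l, nat -> rel 'I_(n l))
  (* every agent is its own neighbour *)
  (HEself : forall l t i, E l t i i)
  (B : bool -> nat) (HB : forall l, (1 <= B l)%N)
  (HEconn : forall l, jointly_strongly_connected (E l) (B l))
  (E12 : forall l, nat -> 'I_(n (~~ l)) -> 'I_(n l) -> bool)
  (eta0 : R) (Heta0 : 0 < eta0 < 1)
  (w : forall l, nat -> 'I_(n l) -> 'I_(n l) -> R)
  (Hw0 : forall l t i j, 0 <= w l t i j)
  (HwE : forall l t i j, E l t j i -> eta0 <= w l t i j)
  (HwnE : forall l t i j, ~~ E l t j i -> w l t i j = 0)
  (Hwrow : forall l t i, \sum_j w l t i j = 1)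
  (Hwcol : forall l t j, \sum_i w l t i j = 1)
  (w12 : forall l, nat -> 'I_(n l) -> 'I_(n (~~ l)) -> R)
  (Hw12ge0 : forall l t i j, 0 <= w12 l t i j)
  (Hw12E : forall l t i j, 0 < w12 l t i j -> E12 l t j i)
  (Hw12row : forall l t i, \sum_j w12 l t i j = 1)
  (* regularizers *)
  (psi : forall l, 'rV[R]_(m l) -> R)
  (Hpsidiff : forall l p, X l p -> differentiable (psi l) p)
  (Hpsiconvex : forall l, strongly_convex1 (N l) (X l) (psi l))
  (* algorithm *)
  (alpha : nat -> R) (Halpha0 : forall t, 0 <= alpha t)
  (Halpha : forall s t, (s <= t)%N -> alpha t <= alpha s)
  (x0 : forall l, 'I_(n l) -> 'rV[R]_(m l))
  (Hx0 : forall l i, X l (x0 l i))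
  (x : forall l, 'I_(n l) -> nat -> T -> 'rV[R]_(m l))
  (xis : forall l, 'I_(n l) -> nat -> {RV P >-> dxi.-tuple R})
  (ghat : forall l, 'I_(n l) -> nat -> T -> 'rV[R]_(m l))
  (Hxis_indep : mutually_independent P
     (fun k : {l : bool & 'I_(n l)} * nat =>
        (xis (tag k.1) (tagged k.1) k.2 : T -> dxi.-tuple R)))
  (Hxis_ident : forall l i t (A : set (dxi.-tuple R)), measurable A ->
     distribution P (xis l i t) A = distribution P xi A)
  (Hxinit : forall l i o, x l i 0%N o = x0 l i)
  (Hghat : forall l i t o,
     partial_subdifferential X (fun z => F l i z (xis l i t o))
       (v_of w x i t o) (u_of w12 x i t o) (ghat l i t o))
  (* the sampled subgradient depends on nothing but the data up to time t *)
  (Hghatmeas : forall l i t k,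
     sub_measurable (history x xis t.+1) (fun o => ghat l i t o ord0 k))
  (Hxstep : forall l i t o,
     x l i t.+1 o =
       mirror_map (X l) (psi l) (v_of w x i t o) (- (alpha t *: ghat l i t o)))
  (* (A1) *)
  (L : R) (HL : 0 < L)
  (HA1 : forall l i y1 y2 y1' y2',
     X net1 y1 -> X net1 y1' -> X net2 y2 -> X net2 y2' ->
     `|f l i (y1, y2) - f l i (y1', y2')|
       <= L * (N net1 (y1 - y1') + N net2 (y2 - y2')))
  (* (A2) *)
  (nu : bool -> R) (Hnu : forall l, 0 < nu l)
  (g : forall l, 'I_(n l) -> nat -> T -> 'rV[R]_(m l))
  (Hg : forall l i t o,
     partial_subdifferential X (f l i)
       (v_of w x i t o) (u_of w12 x i t o) (g l i t o))
  (HA2mean : forall l i t k,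
     is_cond_expectation P (history x xis t)
       (fun o => ghat l i t o ord0 k) (fun o => g l i t o ord0 k))
  (HA2var : forall l i t, exists2 Z : T -> R,
     is_cond_expectation P (history x xis t)
       (fun o => dual_norm (N l) (g l i t o - ghat l i t o) ^+ 2) Z &
     {ae P, forall o, Z o <= nu l ^+ 2})
  (* the subgradients of the L-Lipschitz costs obey the Lipschitz constant *)
  (HgL : forall l i t o, dual_norm (N l) (g l i t o) <= L)
  (* (A3) *)
  (HA3convex : forall l y, X l y ->
     convex_function (X l) (fun p => bregman (psi l) y p))
  (HA3cvg : forall l (y_ : nat -> 'rV[R]_(m l)) y,
     (forall k, X l (y_ k)) -> X l y -> y_ @ \oo --> y ->
     (fun k => bregman (psi l) (y_ k) y) @ \oo --> (0 : R))
  (i : 'I_(n net1)) (K : nat) (HK : (1 <= K)%N) :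
  let Gamma l := Gam eta0 (n l) in
  let th l := theta eta0 (n l) (B l) in
  let Lambda l := \big[Num.max/0]_(j < n l) N l (x0 l j) in
  (pseudo_regret P (X net1) (cost f) (x net1 i) (u_of w12 x i) K
   <= (\sum_(1 <= t < K.+1) \sum_(l : bool)
          (L + nu l) * (9 * L + nu l) * alpha (t - 1)%N
       + 4 * L * \sum_(1 <= t < K.+1) \sum_(l : bool)
          (n l)%:R * Gamma l * (L + nu l) *
          \sum_(1 <= s < t) th l ^+ (t - 1 - s) * alpha (s - 1)%N
       + 4 * L * \sum_(1 <= t < K.+1) \sum_(l : bool)
          (n l)%:R * Gamma l * th l ^+ (t - 1) * Lambda l)%:E
      + bregman_diameter (psi net1) (X net1) / (alpha K)%:E)%E.
Proof.
cbv beta zeta.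
(* A subdifferential is nonempty only at points of [X l], so the sampled subgradient certifies
   membership of [v]. *)
have Xv l j t o : X l (v_of w x j t o) by have [] := Hghat l j t o.
case: K HK => // K' _.
pose D := bregman_diameter (psi net1) (X net1); rewrite -/D.
set C := (X in (_ <= X%:E + _)%E).
have CE : C = \sum_(t < K'.+1)
   (\sum_(l : bool) (L + nu l) * (9 * L + nu l) * alpha t +
    4 * L * \sum_(l : bool) (n l)%:R * Gam eta0 (n l) * (L + nu l) *
       \sum_(s < t) theta eta0 (n l) (B l) ^+ (t - s.+1) * alpha s +
    4 * L * \sum_(l : bool) (n l)%:R * Gam eta0 (n l) * theta eta0 (n l) (B l) ^+ t *
       \big[Num.max/0]_(j < n l) N l (x0 l j)).
  rewrite /C !big_add1 !big_mkord !big_split /= -!mulr_sumr; congr (_ + _ * _ + _ * _).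
  - by apply: eq_bigr => t _; apply: eq_bigr => l _; rewrite subn1.
  - apply: eq_bigr => t _; apply: eq_bigr => l _; congr (_ * _).
    rewrite big_add1 big_mkord; apply: eq_bigr => s _.
    by rewrite !subn1.
  - by apply: eq_bigr => t _; apply: eq_bigr => l _; rewrite subn1.
have costE (z : nat -> T -> 'rV[R]_(m net1)) :
  (fun o => \sum_(1 <= t < K'.+2) cost f (z t o, u_of w12 x i t o)) =
  (fun o => \sum_(t < K'.+1) cost f (z t.+1 o, u_of w12 x i t.+1 o)).
  by apply/funext => o; rewrite big_add1 big_mkord.
pose Sx o := \sum_(t < K'.+1) cost f (x net1 i t.+1 o, u_of w12 x i t.+1 o).
pose Sy y o := \sum_(t < K'.+1) cost f (y, u_of w12 x i t.+1 o).
have iSx : integrable_fun P Sx.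
  by eapply total_iterate_cost_integrable; eassumption.
have iSy y : X net1 y -> integrable_fun P (Sy y).
  by move=> Xy; eapply total_fixed_cost_integrable; eassumption.
have main y D' : 0 < alpha K'.+1 -> X net1 y ->
    (forall z, X net1 z -> bregman (psi net1) y z <= D') ->
    \int[P]_o Sx o - \int[P]_o Sy y o <= C + D' / alpha K'.+1.
  move=> aK Xy HD'.
  have [_] : mean_le P (fun o => Sx o - Sy y o)
    (\sum_(t < K'.+1) instant_rate N B eta0 alpha x0 L nu t + D' / alpha K'.+1).
    by eapply regret_mean; eassumption.
  rewrite RintegralB //; last exact: iSy.
  move=> /le_trans; apply; rewrite lerD2r CE; apply: ler_sum => t _.
  by eapply instant_rate_le; eassumption.
have C0 : 0 <= C.
  have Ln l : 0 <= L + nu l by rewrite addr_ge0 // ltW.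
  have L4 : 0 <= 4 * L by rewrite mulr_ge0 ?ler0n ?(ltW HL).
  rewrite CE; apply: sumr_ge0 => t _; rewrite !addr_ge0 //.
  - apply: sumr_ge0 => l _; rewrite !mulr_ge0 // addr_ge0 ?(ltW (Hnu l)) //.
    by rewrite mulr_ge0 ?ler0n ?(ltW HL).
  - apply: mulr_ge0 => //; apply: sumr_ge0 => l _.
    rewrite !mulr_ge0 ?ler0n ?Gam_ge0 //; apply: sumr_ge0 => s _.
    by rewrite mulr_ge0 ?exprn_ge0 ?theta_ge0.
  - apply: mulr_ge0 => //; apply: sumr_ge0 => l _.
    by rewrite !mulr_ge0 ?ler0n ?Gam_ge0 ?exprn_ge0 ?theta_ge0 // bigmax_ge_id.
have -> : pseudo_regret P (X net1) (cost f) (x net1 i) (u_of w12 x i) K'.+1 =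
    ((\int[P]_o Sx o)%R%:E - ereal_inf [set (\int[P]_o Sy y o)%R%:E | y in X net1])%E.
  rewrite /pseudo_regret costE expectationE //; congr (_ - ereal_inf _)%E.
  apply/seteqP; split => _ [y Xy <-]; exists y => //.
    by rewrite (costE (fun _ _ => y)) expectationE //; exact: iSy.
  by rewrite (costE (fun _ _ => y)) expectationE //; exact: iSy.
have regret_le c : (forall y, X net1 y -> \int[P]_o Sx o - \int[P]_o Sy y o <= c) ->
    ((\int[P]_o Sx o)%R%:E - ereal_inf [set (\int[P]_o Sy y o)%R%:E | y in X net1] <= c%:E)%E.
  move=> h.
  have -> : c%:E = ((\int[P]_o Sx o)%R%:E - ((\int[P]_o Sx o) - c)%R%:E)%E.
    by rewrite -EFinB opprB addrC subrK.
  apply: leeB => //; apply: le_ereal_inf_tmp => _ [y Xy <-].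
  by rewrite lee_fin; have := h y Xy; lra.
have D_ge y z : X net1 y -> X net1 z -> ((bregman (psi net1) y z)%:E <= D)%E.
  by move=> Xy Xz; apply: ereal_sup_ubound; exists y => //; exists z.
have [y0 Xy0] := HX0 net1.
have D0 : (0 <= D)%E by have := D_ge _ _ Xy0 Xy0; rewrite bregmanxx.
have [aK0|aK_neq0] := eqVneq (alpha K'.+1) 0.
  (* The inverse of 0 is [+oo], so the bound is infinite unless [D] is 0. In that case [0 * +oo] is
     0, but strong convexity reduces [X net1] to a point: the regret vanishes and [C] is
     nonnegative. *)
  rewrite aK0 inver eqxx.
  have [D_eq0|D_neq0] := eqVneq D 0%E; last first.
    by rewrite gt0_muley ?lt_neqAle 1?eq_sym ?D_neq0 // addey // leey.
  rewrite D_eq0 mul0e adde0; apply: regret_le => y Xy.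
  have single z : X net1 z -> z = y.
    move=> Xz; have := D_ge _ _ Xz Xy; rewrite D_eq0 lee_fin.
    have := bregman_ge (Hpsidiff net1) (Hpsiconvex net1) Xz Xy => h1 h2.
    have N0 : N net1 (z - y) = 0.
      apply/eqP; rewrite -sqrf_eq0 eq_le sqr_ge0 andbT; lra.
    by apply/eqP; rewrite -subr_eq0; apply/eqP; case: (HN net1) => _ _; apply.
  have -> : Sx = Sy y.
    apply/funext => o; apply: eq_bigr => t _; rewrite (single (x net1 i t.+1 o)) //.
    by eapply iterate_in; eassumption.
  by rewrite subrr.
have aK : 0 < alpha K'.+1 by rewrite lt_neqAle eq_sym aK_neq0 Halpha0.
rewrite inver (negbTE aK_neq0).
(* An infinite diameter makes the right-hand side [+oo]. *)
case: (D) D0 D_ge => [D'| |] // D0 D_ge; last first.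
  by rewrite gt0_mulye ?lte_fin ?invr_gt0 // addey // leey.
rewrite -EFinM -EFinD; apply: regret_le => y Xy; apply: main => // z Xz.
by have := D_ge y z Xy Xz; rewrite lee_fin.
Qed.
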